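(* Let $L$ be a positive definite even self dual lattice with bilinear form $(\cdot,\cdot)$, and let $\sigma$ be an involution of $L$ (an automorphism of the lattice $L$ of order $2$) such that the rank of the fixed point sublattice $L^\sigma=\{\alpha\in L : \sigma\alpha=\alpha\}$ is divisible by $8$, and such that $(\alpha,\sigma\alpha)\in 2\mathbb{Z}$ for all $\alpha\in L$. Let $M=(1-\sigma)L$, $N=L\cap (M\otimes_{\mathbb{Z}}\mathbb{Q})$, and $A=N/M$. Let $\mathcal{H}$ be the finite Heisenberg group associated with $L$ and $\sigma$, i.e. the central extension $$1\to \mathbb{C}^\times\to \mathcal{H}\to A\to 1$$ with commutator form $B(\alpha,\beta)=(-1)^{(\alpha,\beta)}$, and let $X$ be the unique irreducible $\mathcal{H}$-module on which $\mathbb{C}^\times$ acts by scalar multiplication. Then the (unique up to scalar) nondegenerate invariant bilinear form on $X$ is symmetric. Here a bilinear form $(\cdot,\cdot)_X: X\times X\to\mathbb{C}$ is called invariant if $$(hx,y)_X=(-1)^{(\alpha,\alpha)/2}\,(x,hy)_X$$ for all $x,y\in X$, all $\alpha\in N$ and all $h\in\mathcal{H}$ whose image in $A=N/M$ is the class of $\alpha$.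
   Context: An integral lattice is a free abelian group $L$ of finite rank with a nondegenerate symmetric bilinear form $(\cdot,\cdot):L\times L\to\mathbb{Z}$, extended linearly to $L\otimes_{\mathbb{Z}}\mathbb{Q}$. It is even if $(\alpha,\alpha)\in2\mathbb{Z}$ for all $\alpha\in L$, and self dual if $L=L^\vee=\{x\in L\otimes_{\mathbb Z}\mathbb{Q} : (x,\alpha)\in\mathbb{Z}\text{ for all }\alpha\in L\}$. Automorphisms of $L$ preserve the bilinear form. Central extensions of a finite abelian group $A$ by $\mathbb{C}^\times$ are classified up to isomorphism by $H^2(A,\mathbb{C}^\times)$ (trivial action), and the class $[\psi]$ of a $2$-cocycle $\psi$ is determined by the alternating bimultiplicative form $B(\alpha,\beta)=\psi(\alpha,\beta)/\psi(\beta,\alpha)$, every such alternating form arising this way. Thus $\mathcal{H}$ is characterised by the condition that any $h,k\in\mathcal{H}$ lying over $\alpha,\beta\in A$ satisfy $hkh^{-1}k^{-1}=B(\alpha,\beta)\in\mathbb{C}^\times\subset\mathcal{H}$. Here $(-1)^{(\alpha,\beta)}$ is computed with representatives of $\alpha,\beta$ in $N$. *)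

(* Defs.v *)
From HB Require Import structures.
From mathcomp Require Import all_boot all_order all_algebra.
From mathcomp Require Import boolp classical_sets reals complex.

Set Implicit Arguments.
Unset Strict Implicit.
Unset Printing Implicit Defensive.

Import Order.TTheory GRing.Theory Num.Theory.
Local Open Scope classical_set_scope.
Local Open Scope ring_scope.

Definition is_Zbasis (G : zmodType) (S : set G) (r : nat) (e : 'I_r -> G) :=
  (forall i, S (e i)) /\
  (forall x, S x -> exists! c : 'rV[int]_r, x = \sum_i e i *~ c 0 i).

Definition has_rank (G : zmodType) (S : set G) (r : nat) :=
  exists e : 'I_r -> G, is_Zbasis S e.

(* The Z-basis carried by the record only serves to give a concrete model of
   L ⊗ Q; nothing below depends on its choice. *)
Record integral_lattice := IntegralLattice {
  lat_sort :> zmodType;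
  lat_rank : nat;
  lat_basis : 'I_lat_rank -> lat_sort;
  lat_basisP : is_Zbasis setT lat_basis;
  lat_form : lat_sort -> lat_sort -> int;
  lat_formDl : forall x y z,
    lat_form (x + y) z = lat_form x z + lat_form y z;
  lat_formC : forall x y, lat_form x y = lat_form y x;
  lat_form_nondeg : forall x, (forall y, lat_form x y = 0) -> x = 0
}.

Section Lattice.
Variable L : integral_lattice.

Definition lat_coord (x : L) : 'rV[int]_(lat_rank L) :=
  xget 0 [set c : 'rV[int]_(lat_rank L) | x = \sum_i lat_basis i *~ c 0 i].

(* L ⊗ Q, in coordinates with respect to the basis (e_i ⊗ 1). *)
Definition lat_Q := 'rV[rat]_(lat_rank L).

Definition lat_emb (x : L) : lat_Q := map_mx intr (lat_coord x).

Definition lat_formQ (x y : lat_Q) : rat :=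
  \sum_i \sum_j x 0 i * y 0 j * (@lat_form L (lat_basis i) (lat_basis j))%:~R.

Definition is_positive_definite :=
  forall x : L, x != 0 -> 0 < lat_form x x.

Definition is_even := forall x : L, (2 %| lat_form x x)%Z.

Definition dual_lattice : set lat_Q :=
  [set x | forall a : L, lat_formQ x (lat_emb a) \is a Num.int].

Definition is_self_dual := range lat_emb = dual_lattice.

Definition is_automorphism (s : L -> L) :=
  bijective s /\ (forall x y, lat_form (s x) (s y) = lat_form x y).

Definition has_order_two (s : L -> L) :=
  (forall x, s (s x) = x) /\ (exists x, s x != x).

Definition fixed_sublattice (s : L -> L) : set L := [set x | s x = x].

Definition Qspan (S : set L) : set lat_Q :=
  [set v | exists s : seq L, (forall x, x \in s -> S x) /\
                             v \in <<[seq lat_emb x | x <- s]>>%VS].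

Lemma lat_coordP (x : L) : x = \sum_i lat_basis i *~ lat_coord x 0 i.
Proof.
have [_ /(_ x I) [c [hc _]]] := lat_basisP L.
rewrite /lat_coord; case: xgetP => [d _ //|/(_ c)]; by move/(_ hc).
Qed.

Lemma lat_coordB (x y : L) : lat_coord (x - y) = lat_coord x - lat_coord y.
Proof.
have [_ /(_ (x - y) I) [c [_ uc]]] := lat_basisP L.
rewrite -(uc _ (lat_coordP _)); apply: uc.
rewrite {1}(lat_coordP x) {1}(lat_coordP y) -sumrB.
by apply: eq_bigr => i _; rewrite !mxE mulrzBr.
Qed.

Lemma lat_embB (x y : L) : lat_emb (x - y) = lat_emb x - lat_emb y.
Proof. by rewrite /lat_emb lat_coordB map_mxB. Qed.

End Lattice.

Section DiscriminantQuotient.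
Variables (L : integral_lattice) (s : {additive L -> L}).

(* M = (1 - s) L *)
Definition latM : {pred L} := fun x => `[< exists y, x = y - s y >].

(* N = L ∩ (M ⊗ Q) *)
Definition latN : {pred L} := fun x => `[< Qspan [set` latM] (lat_emb x) >].

Lemma latM_zmod_closed : zmod_closed latM.
Proof.
split; first by apply/asboolP; exists 0; rewrite raddf0 subr0.
move=> _ _ /asboolP[x ->] /asboolP[y ->]; apply/asboolP; exists (x - y).
by rewrite raddfB opprD !opprK opprB addrACA [s y - _]addrC.
Qed.

HB.instance Definition _ := GRing.isZmodClosed.Build L latM latM_zmod_closed.

Lemma latN_zmod_closed : zmod_closed latN.
Proof.
split.
  apply/asboolP; exists [::]; split=> //.
  by rewrite -(subrr 0) lat_embB subrr mem0v.
move=> x y /asboolP[u [hu xu]] /asboolP[v [hv yv]]; apply/asboolP.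
exists (u ++ v); split.
  by move=> z; rewrite mem_cat => /orP[/hu|/hv].
rewrite map_cat span_cat lat_embB; apply: memvB.
  exact: (subvP (addvSl _ _)).
exact: (subvP (addvSr _ _)).
Qed.

HB.instance Definition _ := GRing.isZmodClosed.Build L latN latN_zmod_closed.

Definition latN_type := {x : L | x \in latN}.
HB.instance Definition _ := SubChoice.on latN_type.
HB.instance Definition _ := [SubChoice_isSubZmodule of latN_type by <:].

Definition latMN : {pred latN_type} := fun x => val x \in latM.

Lemma latMN_zmod_closed : zmod_closed latMN.
Proof.
have E x : (x \in latMN) = (val x \in latM) by [].
split; first by rewrite E raddf0 rpred0.
by move=> x y; rewrite !E raddfB => hx hy; rewrite rpredB.
Qed.

HB.instance Definition _ :=
  GRing.isZmodClosed.Build latN_type latMN latMN_zmod_closed.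

(* A = N / M *)
Definition latA : zmodType := Quotient.quot latMN.

Definition classA (x : latN_type) : latA := \pi_(Quotient.quot latMN)%qT x.

Lemma latM_subN (x : L) : x \in latM -> x \in latN.
Proof.
move=> xM; apply/asboolP; exists [:: x]; split.
  by move=> y; rewrite inE => /eqP->.
by rewrite /= memv_span // inE.
Qed.

Lemma classA_eq (x y : latN_type) :
  classA x = classA y <-> (val x - val y) \in latM.
Proof.
rewrite -raddfB -[val _ \in latM]/((x - y) \in latMN).
rewrite (Quotient.idealrBE latMN x y).
by split=> /eqP.
Qed.

End DiscriminantQuotient.

(* A central extension 1 -> C^* -> H -> N/M -> 1 with commutator form
   (-1)^(a, b).  The embedding of C^* is given by a function on C of which only
   the values at nonzero scalars matter. *)
Record heisenberg_group (R : realType) (L : integral_lattice)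
    (s : {additive L -> L}) := HeisenbergGroup {
  heis_sort :> groupType;
  heis_scalar : R[i] -> heis_sort;
  heis_proj : heis_sort -> latA s;
  heis_scalarM : forall c d : R[i], c != 0 -> d != 0 ->
    heis_scalar (c * d) = (heis_scalar c * heis_scalar d)%g;
  heis_scalar_inj : forall c d : R[i], c != 0 -> d != 0 ->
    heis_scalar c = heis_scalar d -> c = d;
  heis_projM : forall h k : heis_sort,
    heis_proj (h * k)%g = heis_proj h + heis_proj k;
  heis_proj_surj : forall a : latA s, exists h : heis_sort, heis_proj h = a;
  heis_exact : forall h : heis_sort,
    heis_proj h = 0 <-> exists c : R[i], c != 0 /\ h = heis_scalar c;
  heis_central : forall (c : R[i]) (h : heis_sort), c != 0 ->
    (heis_scalar c * h)%g = (h * heis_scalar c)%g;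
  heis_commutator : forall (h k : heis_sort) (a b : latN_type s),
    heis_proj h = classA a -> heis_proj k = classA b ->
    (h * k * h^-1 * k^-1)%g = heis_scalar ((-1) ^ lat_form (val a) (val b))
}.

Section Modules.
Variables (R : realType) (L : integral_lattice) (s : {additive L -> L}).
Variables (H : heisenberg_group R s) (X : lmodType R[i]).
Variable rho : H -> {linear X -> X}.

Definition is_action :=
  (forall x, rho 1%g x = x) /\
  (forall h k x, rho (h * k)%g x = rho h (rho k x)).

Definition scalars_act_by_scaling :=
  forall (c : R[i]) x, c != 0 -> rho (heis_scalar H c) x = c *: x.

Definition is_submodule (W : set X) :=
  [/\ W 0, (forall (c : R[i]) x y, W x -> W y -> W (c *: x + y))
     & (forall h x, W x -> W (rho h x))].

Definition is_irreducible :=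
  (exists x : X, x != 0) /\
  (forall W : set X, is_submodule W -> W = [set 0] \/ W = setT).

Definition is_nondegenerate (f : {biscalar X}) :=
  (forall x, (forall y, f x y = 0) -> x = 0) /\
  (forall y, (forall x, f x y = 0) -> y = 0).

Definition is_invariant (f : {biscalar X}) :=
  forall (x y : X) (a : latN_type s) (h : H), heis_proj h = classA a ->
    f (rho h x) y = (-1) ^ (lat_form (val a) (val a) %/ 2)%Z * f x (rho h y).

Definition is_symmetric (f : {biscalar X}) := forall x y : X, f x y = f y x.

End Modules.

(* Main.v *)
(* The space X carries an irreducible action of H, so sum_a h_a (x) h_a^-1, with
   a running over A = N/M, is a positive multiple c of the swap of X (x) X.
   Applying an invariant form f gives S f(x, y) = c f(y, x), where S is the sum
   of the signs (-1)^((a, a)/2) over A; hence f is symmetric as soon as S > 0,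
   and S <> 0 also yields existence, by averaging.

   The sign of S is Milgram's formula for M with the form (.,.)/2, whose dual
   lattice is N. A full-rank orthogonal sublattice of M reduces the Gauss sum to
   a product of quadratic Gauss sums sum_(k < n) exp(i pi k^2 / n), n even, each
   with argument pi/4 by Gauss' product formula; so S has argument rk(N) pi/4.
   The same reduction applied to L itself, where the Gauss sum is 1, shows
   8 | rk L, and therefore 8 | rk N = rk L - rk L^s. *)
Require Import Defs.
From HB Require Import structures.
From mathcomp Require Import all_boot all_order all_algebra.
From mathcomp Require Import boolp classical_sets reals complex trigo.
From mathcomp Require Import ring zify.

Set Implicit Arguments.
Unset Strict Implicit.
Unset Printing Implicit Defensive.

Import Order.TTheory GRing.Theory Num.Theory.
Local Open Scope ring_scope.

(** * Quadratic Gauss sums *)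

(** Evenness of (a, s a) makes (y, y) divisible by 4 for y in M; hence (.,.)/2 is even on M, and
    (-1)^((a, a)/2) depends only on the class of a in A. Self duality of L enters through the
    representability of integral functionals: for L itself and, after a pullback along 1 - s, to
    identify N with the dual of M. Quotients and indices are avoided: a Gauss sum is taken over
    coordinate vectors in a box (Z/m)^k, which meets all classes equally often, and since only the
    argument of the sum matters this multiplicity is harmless. X is an arbitrary module, so its
    finite dimension must first be extracted from irreducibility and the finiteness of A; only then
    are Schur's lemma and traces available. *)

Section GaussBinomial.
Variables (F : comNzRingType) (q : F).

(** The Gauss binomial coefficient, given by the q-Pascal rule instead of a quotient of q-factorials
    so that q may be a root of unity. *)
Fixpoint qbin (n k : nat) : F :=
  match n, k with
  | _, 0%N => 1
  | 0%N, _.+1 => 0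
  | n'.+1, k'.+1 => qbin n' k' + q ^+ k'.+1 * qbin n' k'.+1
  end.

Lemma qbin0 n : qbin n 0 = 1. Proof. by case: n. Qed.

Lemma qbinS n k :
  qbin n.+1 k.+1 = qbin n k + q ^+ k.+1 * qbin n k.+1.
Proof. by []. Qed.

Lemma qbin_small n k : (n < k)%N -> qbin n k = 0.
Proof.
elim: n k => [|n IHn] [|k] //; rewrite ltnS => nk.
by rewrite qbinS !IHn ?mulr0 ?addr0 // ltnW.
Qed.

(** The q-analogue of (k + 1) C(n + 1, k + 1) = (n + 1) C(n, k). At a root of unity the right-hand
    side can vanish, which is how [qbin_root] evaluates the coefficients. *)
Lemma qbin_absorb n k :
  (1 - q ^+ k.+1) * qbin n.+1 k.+1 = (1 - q ^+ n.+1) * qbin n k.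
Proof.
elim: n k => [|n IHn] [|k].
- by rewrite /= mulr0 addr0 expr1.
- by rewrite /= mulr0 addr0 !mulr0.
- rewrite qbinS !qbin0 mulrDr mulrCA IHn qbin0.
  by rewrite [q ^+ n.+2]exprS expr1; ring.
rewrite qbinS mulrDr mulrCA IHn.
have /eqP := IHn k; rewrite -subr_eq0 => /eqP Ek.
have Eq := qbinS n k.
apply/eqP; rewrite -subr_eq0; apply/eqP.
(* The goal as a combination of the induction hypothesis [Ek] and the q-Pascal rule [Eq], both of
   which make their bracket vanish. *)
transitivity (q * ((1 - q ^+ k.+1) * qbin n.+1 k.+1
    - (1 - q ^+ n.+1) * qbin n k) + (q * (1 - q ^+ n.+1)) *
    (qbin n k + q ^+ k.+1 * qbin n k.+1 - qbin n.+1 k.+1)).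
  by rewrite [q ^+ k.+2]exprS [q ^+ n.+2]exprS; ring.
by rewrite Ek -Eq subrr !mulr0 addr0.
Qed.

Arguments qbin : simpl never.

Definition rogers_szego n t := \sum_(k < n.+1) t ^+ k * qbin n k.

Lemma rogers_szegoS n t :
  rogers_szego n.+1 t = t * rogers_szego n t + rogers_szego n (q * t).
Proof.
rewrite /rogers_szego big_ord_recl qbin0 mulr1 [X in _ = _ + X]big_ord_recl.
rewrite qbin0 mulr1 !expr0 addrCA; congr (_ + _).
rewrite (eq_bigr (fun i : 'I_n.+1 => t * (t ^+ i * qbin n i)
   + (q * t) ^+ i.+1 * qbin n i.+1)); last first.
  move=> i _; rewrite lift0 qbinS exprMn.
  by rewrite [t ^+ i.+1]exprS; ring.
rewrite big_split /= mulr_sumr; congr (_ + _).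
by rewrite big_ord_recr /= qbin_small // mulr0 addr0.
Qed.

Lemma rogers_szegoB n t :
  rogers_szego n.+1 t - rogers_szego n.+1 (q * t) =
  t * (1 - q ^+ n.+1) * rogers_szego n t.
Proof.
rewrite /rogers_szego -sumrB big_ord_recl !expr0 subrr add0r mulr_sumr.
apply: eq_bigr => i _; rewrite lift0 exprMn.
transitivity (t ^+ i.+1 * ((1 - q ^+ i.+1) * qbin n.+1 i.+1)); first by ring.
by rewrite qbin_absorb exprS; ring.
Qed.

(** Eliminating the value at q t between the two preceding identities leaves a recurrence in n at a
    fixed t. *)
Lemma rogers_szegoSS n t :
  rogers_szego n.+2 t =
  (1 + t) * rogers_szego n.+1 t - t * (1 - q ^+ n.+1) * rogers_szego n t.
Proof. by rewrite -rogers_szegoB rogers_szegoS; ring. Qed.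

End GaussBinomial.

Arguments qbin : simpl never.

(** At q = y^2, t = y the recurrence collapses: 1 - y^(2n+2) has the factor 1 + y^(n+1), and (1 + y)
    - y (1 - y^(n+1)) = 1 + y^(n+2). Two consecutive values are carried because the recurrence has
    order two. *)
Lemma rogers_szego_sqr (F : comNzRingType) (y : F) n :
  rogers_szego (y ^+ 2) n y = \prod_(j < n) (1 + y ^+ j.+1).
Proof.
suff: rogers_szego (y ^+ 2) n y = \prod_(j < n) (1 + y ^+ j.+1) /\
  rogers_szego (y ^+ 2) n.+1 y = \prod_(j < n.+1) (1 + y ^+ j.+1) by case.
elim: n => [|n [IHn IHn1]].
  rewrite big_ord0 big_ord1 /rogers_szego big_ord1 big_ord_recl big_ord1 lift0.
  by rewrite qbinS !qbin0 qbin_small // mulr0 addr0 !mulr1.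
split=> //; rewrite rogers_szegoSS IHn IHn1 [in RHS]big_ord_recr /=.
rewrite big_ord_recr /= -exprM (_ : (2 * n.+1)%N = (n.+1 + n.+1)%N); last lia.
by rewrite exprD [y ^+ n.+2]exprS; ring.
Qed.

(** As q = y^2 has exact order n + 1, absorption kills the coefficient (n+1, k+1) for k < n, so
    q-Pascal says that (n, k) is -q^(k+1) times (n, k+1). The exponent k^2 + k is twice 1 + ... +
    k. *)
Lemma qbin_root (F : fieldType) (y : F) n k :
    y ^+ (2 * n.+1) = 1 ->
    (forall j, (0 < j <= n)%N -> y ^+ (2 * j) != 1) -> (k <= n)%N ->
  y ^+ (k ^ 2 + k) * qbin (y ^+ 2) n k = (-1) ^+ k.
Proof.
move=> yn yj; elim: k => [|k IHk] kn; first by rewrite qbin0 !expr0 mulr1.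
have nz : 1 - (y ^+ 2) ^+ k.+1 != 0.
  by rewrite subr_eq0 -exprM eq_sym yj.
have := qbin_absorb (y ^+ 2) n k; rewrite -[(y ^+ 2) ^+ n.+1]exprM.
rewrite yn subrr mul0r.
move/eqP; rewrite mulf_eq0 (negPf nz) /= qbinS addr_eq0 => /eqP E.
have -> : (k.+1 ^ 2 + k.+1 = k ^ 2 + k + 2 * k.+1)%N by lia.
have H := IHk (ltnW kn).
rewrite exprD -mulrA exprM [X in _ * X]( _ : _ = - qbin (y ^+ 2) n k).
  by rewrite mulrN H exprS mulN1r.
by rewrite E opprK.
Qed.

(* The value at t = y of the Rogers-Szego polynomial with q = y^2 a primitive
   n-th root of unity, where the Gauss binomials become powers of y up to
   sign: this is Gauss' own evaluation of his sums. *)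
Lemma gauss_sum_product (F : fieldType) (w : F) n :
    w != 0 -> w ^+ (2 * n.+1) = 1 ->
    (forall j, (0 < j <= n)%N -> w ^+ (2 * j) != 1) ->
  \sum_(k < n.+1) w ^+ (k ^ 2) = \prod_(j < n) (1 + (- w^-1) ^+ j.+1).
Proof.
move=> w0 wn wj; rewrite -rogers_szego_sqr; apply: eq_bigr => k _.
(* With this y, [qbin_root] gives y^k qbin = (-1)^k y^(-k^2) = w^(k^2), as k and k^2 have the same
   parity. *)
set y := - w^-1.
have yE j : y ^+ (2 * j) = w ^- (2 * j).
  by rewrite exprM sqrrN -exprM exprVn.
have yn : y ^+ (2 * n.+1) = 1 by rewrite yE wn invr1.
have yj j : (0 < j <= n)%N -> y ^+ (2 * j) != 1.
  by move=> jn; rewrite yE invr_eq1 wj.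
have := qbin_root yn yj (leq_ord k).
have y0 : y != 0 by rewrite oppr_eq0 invr_eq0.
rewrite exprD -mulrA => E; apply: (mulfI (expf_neq0 (k ^ 2) y0)).
rewrite E /y [(- w^-1) ^+ _]exprNn exprVn -[LHS]mulrA mulVf ?expf_neq0 // mulr1.
by rewrite -signr_odd oddX /= signr_odd.
Qed.

(** * Arguments of Gauss sums on the unit circle *)

Section UnitCircle.
Variable R : realType.
Local Open Scope complex_scope.

Definition cis (x : R) : R[i] := (cos x) +i* (sin x).

Lemma cisD x y : cis (x + y) = cis x * cis y.
Proof.
by apply/eqP; rewrite eq_complex /= cosD sinD addrC [sin x * _ + _]addrC !eqxx.
Qed.

Lemma cis0 : cis 0 = 1.
Proof. by rewrite /cis cos0 sin0. Qed.

Lemma cis_neq0 x : cis x != 0.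
Proof.
apply/eqP => cx; have := oner_neq0 R[i].
by rewrite -cis0 -(subrr x) cisD cx mul0r eqxx.
Qed.

Lemma cisV x : (cis x)^-1 = cis (- x).
Proof.
by apply: (mulfI (cis_neq0 x)); rewrite mulfV ?cis_neq0 // -cisD subrr cis0.
Qed.

Lemma cisMn x n : cis x ^+ n = cis (x *+ n).
Proof.
by elim: n => [|n IHn]; rewrite ?cis0 // exprS mulrS cisD IHn.
Qed.

Lemma cis_sum I (r : seq I) (F : I -> R) :
  \prod_(i <- r) cis (F i) = cis (\sum_(i <- r) F i).
Proof. by rewrite (big_morph cis cisD cis0). Qed.

Lemma cis_pi : cis pi = -1.
Proof. by apply/eqP; rewrite eq_complex /= cospi sinpi oppr0 !eqxx. Qed.

(** For 0 < x < pi / 2, this and the next identity split a factor of Gauss' product into a positive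
    modulus and an explicit argument. *)
Lemma add1cis x :
  1 + cis (- (x *+ 2)) = (cos x *+ 2)%:C * cis (- x).
Proof.
apply/eqP; rewrite eq_complex /= !cosN !sinN cos_mulr2n sin_mulr2n !mul0r.
by apply/andP; split; apply/eqP; ring.
Qed.

Lemma sub1cis x :
  1 - cis (- (x *+ 2)) = (sin x *+ 2)%:C * cis (pi / 2 - x).
Proof.
apply/eqP; rewrite eq_complex /= !cosN !sinN cos_mulr2n sin_mulr2n !mul0r.
rewrite cosB sinB cos_pihalf sin_pihalf cos2sin2.
by apply/andP; split; apply/eqP; ring.
Qed.

Lemma cis_expr_neq1 (N j : nat) : (0 < j < N)%N ->
  cis (pi / N%:R) ^+ (2 * j) != 1.
Proof.
move=> /andP[j0 jN]; rewrite mulnC exprM sqrf_eq1 cisMn.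
have N0 : 0 < N%:R :> R by rewrite ltr0n (leq_trans _ jN).
suff s0 : 0 < sin (pi / N%:R *+ j) :> R.
  by rewrite !eq_complex /= oppr0 !(gt_eqF s0) !andbF.
apply: sin_gt0_pi; rewrite -mulr_natr pmulr_rgt0 ?ltr0n //; last first.
  by rewrite divr_gt0 ?pi_gt0.
rewrite j0 mulrAC -mulrA gtr_pMr ?pi_gt0 // ltr_pdivrMr // mul1r ltr_nat.
by rewrite jN.
Qed.

(** Odd exponents contribute the pi / 2 of [sub1cis]; there are a + 1 of them among 1, ..., 2a + 1,
    and all these exponents add up to (a + 1)(2a + 1). *)
Lemma sum_gauss_angle (c : R) a :
  \sum_(j < a.*2.+1) ((odd j.+1)%:R * (pi / 2) - c *+ j.+1) =
  pi / 2 *+ a.+1 - c *+ (a.+1 * a.*2.+1).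
Proof.
pose G j := (odd j.+1)%:R * (pi / 2) - c *+ j.+1.
rewrite -[LHS]/(\sum_(j < _) G j).
elim: a => [|a IHa]; first by rewrite big_ord1 /G /= mul1r !muln1.
rewrite doubleS 2!big_ord_recr /= IHa /G !oddS odd_double /= mul0r mul1r.
rewrite -!(mulr_natr c) -!(mulr_natr (_ / _)) -muln2 !natrM -!natr1 !natrM.
by ring.
Qed.

Lemma gauss_sum_even a : (0 < a)%N ->
  exists2 t : R[i], 0 < t &
  \sum_(k < a.*2) cis (pi / a.*2%:R) ^+ (k ^ 2) = t * cis (pi / 4).
Proof.
(* Half of the angle pi / N: every c (j + 1) with j + 1 < N lies in (0, pi / 2), where sine and
   cosine are positive. *)
case: a => // a _; set N := a.+1.*2; set c : R := pi / N.*2%:R.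
have N0 : N%:R != 0 :> R by rewrite pnatr_eq0.
have cE : pi / N%:R = c *+ 2.
  by rewrite /c -muln2 natrM -mulr_natr; field.
change (exists2 t : R[i], 0 < t &
  \sum_(k < a.*2.+2) cis (pi / N%:R) ^+ (k ^ 2) = t * cis (pi / 4)).
rewrite gauss_sum_product.
- have F j : exists2 t : R[i], 0 < t & (j < a.*2.+1)%N ->
    1 + (- (cis (pi / N%:R))^-1) ^+ j.+1 =
    t * cis ((odd j.+1)%:R * (pi / 2) - c *+ j.+1).
    case: (ltnP j a.*2.+1) => [jN|]; last by exists 1.
    have jc : 0 < c *+ j.+1 < pi / 2.
      have c0 : 0 < c by rewrite divr_gt0 ?pi_gt0 // ltr0n.
      rewrite pmulrn_lgt0 // c0 /= /c -[_ *+ j.+1]mulr_natr mulrAC -mulrA.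
      rewrite ltr_pM2l ?pi_gt0 // ltr_pdivrMr ?ltr0n // -[N.*2]muln2 natrM.
      by rewrite mulrCA mulVf ?mulr1 ?ltr_nat ?pnatr_eq0.
    rewrite cE cisV exprNn cisMn mulNrn -mulrnA mulnC mulrnA -signr_odd.
    case: (odd j.+1); rewrite ?expr1 ?mulN1r ?mul1r ?expr0 ?mul0r ?add0r.
      exists (sin (c *+ j.+1) *+ 2)%:C; last by rewrite sub1cis.
      rewrite ltcR pmulrn_lgt0 // sin_gt0_pi //.
      case/andP: jc => -> jc; apply: (lt_trans jc).
      by rewrite ltr_pdivrMr // ltr_pMr ?pi_gt0 // ltr1n.
    exists (cos (c *+ j.+1) *+ 2)%:C; last by rewrite add1cis.
    rewrite ltcR pmulrn_lgt0 // cos_gt0_pihalf //.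
    case/andP: jc => j0 ->; rewrite andbT; apply: lt_trans j0.
    by rewrite oppr_lt0 divr_gt0 ?pi_gt0.
  have [t t0 tE] : exists2 t : nat -> R[i], (forall j, 0 < t j) &
      forall j, (j < a.*2.+1)%N -> 1 + (- (cis (pi / N%:R))^-1) ^+ j.+1 =
      t j * cis ((odd j.+1)%:R * (pi / 2) - c *+ j.+1).
    exists (fun j => projT1 (cid2 (F j))) => j; by case: cid2.
  exists (\prod_(j < a.*2.+1) t j); first by apply: prodr_gt0.
  rewrite (eq_bigr _ (fun (j : 'I__) _ => tE j (ltn_ord j))) big_split /=.
  (* The total argument is (a + 1) pi / 2 - (2a + 1) pi / 4 = pi / 4. *)
  congr (_ * _); rewrite cis_sum sum_gauss_angle; congr cis.
  rewrite -!(mulr_natr c) -(mulr_natr (_ / 2)) /c /N.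
  rewrite -!muln2 !natrM -!natr1 natrM.
  by field; rewrite natr1 pnatr_eq0.
- exact: cis_neq0.
- rewrite mulnC exprM cisMn -[_ *+ _]mulr_natr divfK //.
  by rewrite cis_pi expr2 mulrNN mulr1.
- by move=> j; rewrite -ltnS; apply: (@cis_expr_neq1 N).
Qed.

End UnitCircle.

(** Since d is even, x^2 modulo 2 d depends only on x modulo d, so the sum runs through t full
    periods. *)
Lemma gauss_sum_period (R : realType) (t d : nat) :
    (0 < t)%N -> (0 < d)%N -> ~~ odd d ->
  exists2 p : R[i], 0 < p &
  \sum_(x < t * d) cis (pi / d%:R) ^+ (x ^ 2) = p * cis (pi / 4).
Proof.
move=> t0 d0 dE; have dd := even_halfK dE.
have [|p p0 pE] := @gauss_sum_even R d./2; first by lia.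
rewrite dd in pE; set u := cis (pi / d%:R) in pE *.
have u1 : u ^+ (2 * d) = 1.
  rewrite mulnC exprM cisMn -[_ *+ _]mulr_natr divfK ?pnatr_eq0 -?lt0n //.
  by rewrite cis_pi expr2 mulrNN mulr1.
exists (t%:R * p); first by rewrite mulr_gt0 ?ltr0n.
rewrite -(big_mkord xpredT (fun x => u ^+ (x ^ 2))) big_nat_mul.
rewrite (eq_bigr (fun=> p * cis (pi / 4))) => [|i _].
  by rewrite big_const_nat iter_addr_0 subn0 -[LHS]mulr_natl mulrA.
rewrite -pE -(big_mkord xpredT (fun x => u ^+ (x ^ 2))).
rewrite -[in LHS](add0n (i * d)%N) big_addn mulSn addnK.
apply: eq_big_nat => x _.
have -> : ((x + i * d) ^ 2 = x ^ 2 + 2 * d * (i * x + d./2 * i ^ 2))%N.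
  by rewrite -{1 2}dd; nia.
by rewrite exprD exprM u1 expr1n mulr1.
Qed.

(* With m = t_i d_i, the form with Gram matrix diag(1 / d_i) on Z^k is
   diag_form / m, and gauss_char x = exp(i pi diag_form x x / m). *)
Section BoxSums.
Variables (R : realType) (k m : nat) (t d : 'I_k -> nat).
Hypotheses (m_gt1 : (1 < m)%N) (tdm : forall i, (t i * d i)%N = m).
Hypothesis d_even : forall i, ~~ odd (d i).

Let w : R[i] := cis (pi / m%:R).

Definition diag_form (x y : {ffun 'I_k -> int}) : int :=
  \sum_i (t i)%:Z * x i * y i.

Definition box_val (x : {ffun 'I_k -> 'Z_m}) : {ffun 'I_k -> int} :=
  [ffun i => (x i : nat)%:Z].

Definition box_red (y : {ffun 'I_k -> int}) : {ffun 'I_k -> 'Z_m} :=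
  [ffun i => (y i)%:~R].

Lemma intr_Zp_eq0 (z : int) : (z%:~R == 0 :> 'Z_m) = (m%:Z %| z)%Z.
Proof.
have pos : m%:Z != 0 by rewrite eqz_nat -lt0n ltnW.
rewrite {1}(divz_eq z m%:Z) rmorphD rmorphM /= -pmulrn pchar_Zp // mulr0 add0r.
have : (0 <= (z %% m%:Z)%Z) by rewrite modz_ge0.
have : (z %% m%:Z < m%:Z)%Z by rewrite ltz_mod.
rewrite (_ : (m%:Z %| z)%Z = ((z %% m%:Z)%Z == 0)); last exact/dvdz_mod0P/eqP.
case: (z %% m%:Z)%Z => // r rm _.
by rewrite -pmulrn -val_eqE /= val_Zp_nat // modn_small.
Qed.

(** Lifting residues to 0, ..., m - 1 is additive only up to carries; the functions summed below are
    insensitive to multiples of m. *)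
Lemma box_valD x y :
  exists z, box_val (x + box_red y) = box_val x + y + z *+ m.
Proof.
have F i :
    exists z : int, box_val (x + box_red y) i = box_val x i + y i + z * m.
  have : (m%:Z %| box_val (x + box_red y) i - (box_val x i + y i))%Z.
    rewrite -intr_Zp_eq0 !ffunE intrB intrD -!pmulrn !natr_Zp.
    by rewrite subrr.
  by case/dvdzP => z E; exists z; rewrite -E addrCA subrr addr0.
have [z zE] := choice F; exists (finfun z); apply/ffunP => i.
by rewrite zE !(ffunE, ffunMnE) -mulr_natr natz.
Qed.

Lemma diag_formC x y : diag_form x y = diag_form y x.
Proof. by apply: eq_bigr => i _; ring. Qed.

Lemma diag_formDl x y z : diag_form (x + y) z = diag_form x z + diag_form y z.
Proof.
by rewrite -big_split; apply: eq_bigr => i _; rewrite ffunE /=; ring.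
Qed.

Lemma diag_formDr x y z : diag_form z (x + y) = diag_form z x + diag_form z y.
Proof. by rewrite diag_formC diag_formDl !(diag_formC z). Qed.

Lemma ffun_mulrnE (x : {ffun 'I_k -> int}) i : (x *+ m) i = x i * m%:Z.
Proof. by rewrite ffunMnE -mulr_natr natz. Qed.

Lemma diag_formMl x y : (m%:Z %| diag_form (x *+ m) y)%Z.
Proof.
apply: rpred_sum => i _; rewrite ffun_mulrnE mulrA mulrAC.
exact/dvdz_mull/dvdzz.
Qed.

(** The factor 2 comes from the evenness of [d i]: t_i m = 2 t_i^2 (d_i / 2). It makes [gauss_char]
    well defined modulo m. *)
Lemma diag_form_sqrM x : ((2 * m)%N%:Z %| diag_form (x *+ m) (x *+ m))%Z.
Proof.
apply: rpred_sum => i _; rewrite ffun_mulrnE; move: (x i) => a.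
apply/dvdzP; exists ((d i)./2%:Z * (t i)%:Z ^+ 2 * a * a).
have mE : m = (t i * ((d i)./2 * 2))%N by rewrite muln2 even_halfK.
by rewrite PoszM {1}mE !PoszM; ring.
Qed.

Let w2m : w ^+ (2 * m) = 1.
Proof.
rewrite mulnC exprM cisMn -[_ *+ _]mulr_natr divfK.
  by rewrite cis_pi expr2 mulrNN mulr1.
by rewrite pnatr_eq0 -lt0n ltnW.
Qed.

Let w0 : w != 0. Proof. exact: cis_neq0. Qed.

Lemma expw_mod z : ((2 * m)%N%:Z %| z)%Z -> w ^ z = 1.
Proof.
by case/dvdzP => c ->; rewrite [c * _]mulrC -exprz_exp -exprnP w2m exp1rz.
Qed.

Lemma diag_sqrD x y :
  diag_form (x + y) (x + y) =
  diag_form x x + diag_form y y + 2 * diag_form x y.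
Proof. by rewrite diag_formDl !diag_formDr (diag_formC y x); ring. Qed.

Definition gauss_char (x : {ffun 'I_k -> int}) : R[i] := w ^ diag_form x x.

Lemma gauss_char_periodic x z : gauss_char (x + z *+ m) = gauss_char x.
Proof.
rewrite /gauss_char diag_sqrD -addrA expfzDr // [X in _ * X]expw_mod ?mulr1 //.
apply: rpredD; first exact: diag_form_sqrM.
by rewrite PoszM diag_formC dvdz_mul // diag_formMl.
Qed.

(** The sum factors over the coordinates, and t_i / m = 1 / d_i turns each factor into t_i periods
    of the one-variable sum. *)
Lemma gauss_sum_box :
  exists2 p : R[i], 0 < p &
  \sum_(x : {ffun 'I_k -> 'Z_m}) gauss_char (box_val x) = p * cis (pi / 4) ^+ k.
Proof.
have mZ : (Zp_trunc m).+2 = m by rewrite Zp_cast.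
have tk i : (0 < t i)%N by case: (t i) (tdm i) m_gt1 => // <-.
have dk i : (0 < d i)%N.
  by case: (d i) (tdm i) m_gt1 => //; rewrite muln0 => <-.
have F i : exists2 p : R[i], 0 < p &
    \sum_(x : 'Z_m) w ^+ (t i * x ^ 2) = p * cis (pi / 4).
  have [p p0 pE] := gauss_sum_period R (tk i) (dk i) (d_even i).
  exists p => //; rewrite -pE tdm.
  rewrite -(big_mkord xpredT (fun x => w ^+ (t i * x ^ 2))) mZ big_mkord.
  apply: eq_bigr => x _; rewrite exprM; congr (_ ^+ _); rewrite cisMn.
  congr cis; rewrite -[_ *+ _]mulr_natr -(tdm i) natrM.
  have := tk i; have := dk i; rewrite !lt0n -!(pnatr_eq0 R) => di ti.
  by field; rewrite ?di ?ti.
have [p p0 pE] : exists2 p : 'I_k -> R[i], (forall i, 0 < p i) &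
    forall i, \sum_(x : 'Z_m) w ^+ (t i * x ^ 2) = p i * cis (pi / 4).
  by exists (fun i => projT1 (cid2 (F i))) => i; case: cid2.
exists (\prod_i p i); first exact: prodr_gt0.
transitivity (\prod_(i < k) \sum_(x : 'Z_m) w ^+ (t i * x ^ 2)); last first.
  by rewrite (eq_bigr _ (fun i _ => pE i)) big_split /= prodr_const card_ord.
rewrite bigA_distr_bigA /=; apply: eq_bigr => x _; rewrite /gauss_char.
rewrite /diag_form (big_morph _ (fun a b => expfzDr a b w0) (expr0z w)).
apply: eq_bigr => i _; rewrite !ffunE -mulrA -!PoszM.
by rewrite -exprnP mulnn.
Qed.


Lemma expw_double_eq1 z : (w ^ (2 * z) == 1) = (m%:Z %| z)%Z.
Proof.
apply/eqP/idP => [|/dvdzP[c ->]]; last first.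
  by apply: expw_mod; rewrite PoszM mulrCA dvdz_mull.
rewrite {1}(divz_eq z m%:Z) mulrDr expfzDr //.
rewrite [X in X * _]expw_mod ?mul1r; last by rewrite PoszM mulrCA dvdz_mull.
have : (z %% m%:Z < m%:Z)%Z by rewrite ltz_pmod // ltz_nat ltnW.
have : (0 <= z %% m%:Z)%Z by rewrite modz_ge0 // eqz_nat -lt0n ltnW.
rewrite (_ : (m%:Z %| z)%Z = ((z %% m%:Z)%Z == 0)); last exact/dvdz_mod0P/eqP.
case: (z %% m%:Z)%Z => // -[|r] // _; rewrite ltz_nat => rm.
rewrite -PoszM -exprnP => /eqP.
by rewrite (negPf (@cis_expr_neq1 R m r.+1 _)).
Qed.

Lemma box_valK x : box_red (box_val x) = x.
Proof. by apply/ffunP => i; rewrite !ffunE -pmulrn natr_Zp. Qed.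

Variables K : {ffun 'I_k -> int} -> Prop.
Hypothesis KB : forall x y, K x -> K y -> K (x - y).
Hypothesis Km : forall z, K (z *+ m).

Let K0 : K 0. Proof. by have := Km 0; rewrite mul0rn. Qed.

Let KN x : K x -> K (- x). Proof. by move=> Kx; rewrite -sub0r; apply: KB. Qed.

Let KD x y : K x -> K y -> K (x + y).
Proof. by move=> Kx Ky; rewrite -[y]opprK; apply/KB/KN. Qed.

Lemma box_sublattice_shift c :
  (fun x => `[< K (box_val (x + box_red c) - c) >]) =1
  (fun x => `[< K (box_val x) >]).
Proof.
move=> x; apply: asbool_equiv_eq; have [z ->] := box_valD x c.
rewrite addrAC addrK; split=> Kx; last exact: KD.
by rewrite -[box_val x](addrK (z *+ m)); apply: KB.
Qed.

(** By translation, all cosets of K have equally many points in the box. This number is the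
    multiplicity that stands in for passing to a quotient. *)
Lemma box_sublattice_card c :
  #|[pred x | `[< K (box_val x - c) >]]| = #|[pred x | `[< K (box_val x) >]]|.
Proof.
rewrite -!sum1_card (reindex_inj (addIr (box_red c))).
by apply: eq_bigl => x; rewrite !inE; apply: box_sublattice_shift.
Qed.

Lemma box_sublattice_card_gt0 : (0 < #|[pred x | `[< K (box_val x) >]]|)%N.
Proof.
apply/card_gt0P; exists 0; rewrite inE.
have -> : box_val 0 = 0 :> {ffun 'I_k -> int}.
  by apply/ffunP => i; rewrite !ffunE.
by apply/asboolP/asboolP.
Qed.

Variable D : {ffun 'I_k -> int} -> Prop.
Hypothesis K_even : forall y, K y -> ((2 * m)%N%:Z %| diag_form y y)%Z.
Hypothesis DP : forall x, D x <-> forall y, K y -> (m%:Z %| diag_form x y)%Z.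

(* Averaging over shifts by elements of K kills the terms outside the dual
   lattice D. *)
Lemma gauss_sum_dual :
  \sum_(x | `[< D (box_val x) >]) gauss_char (box_val x) =
  \sum_x gauss_char (box_val x).
Proof.
set n := #|[pred x | `[< K (box_val x) >]]|.
have n0 : n%:R != 0 :> R[i].
  by rewrite pnatr_eq0 -lt0n box_sublattice_card_gt0.
pose chi x := \sum_(y | `[< K (box_val y) >])
  w ^ (2 * diag_form (box_val x) (box_val y)).
have chiE x : chi x = if `[< D (box_val x) >] then n%:R else 0.
  case: asboolP => [/DP Dx|nDx].
    rewrite /chi (eq_bigr (fun=> 1)) => [|y /asboolP Ky].
      exact: sumr_const.
    by apply/eqP; rewrite expw_double_eq1 Dx.
  have /existsNP[y0 /not_implyP[Ky0 ndvd]] : ~ forall y, K y ->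
    (m%:Z %| diag_form (box_val x) y)%Z by move/DP.
  (* Translating the summation variable by [y0] multiplies the character sum by a factor different
     from 1, so the sum is 0. *)
  have : chi x = chi x * w ^ (2 * diag_form (box_val x) y0).
    rewrite {1}/chi (reindex_inj (addIr (box_red y0))) mulr_suml.
    apply: eq_big => y.
      rewrite -[RHS](box_sublattice_shift y0); apply: asbool_equiv_eq.
      by split=> [/KB|/KD] /(_ _ Ky0) //; rewrite subrK.
    move=> _; have [z ->] := box_valD y y0.
    rewrite !diag_formDr !mulrDr !expfzDr // [X in _ * X](_ : _ = 1) ?mulr1 //.
    by apply/eqP; rewrite expw_double_eq1 diag_formC diag_formMl.
  move/eqP; rewrite -subr_eq0 -{1}[chi x]mulr1 -mulrBr mulf_eq0 subr_eq0.
  rewrite [1 == _]eq_sym expw_double_eq1 (negPf (introN idP ndvd)) orbF.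
  by move/eqP.
apply: (mulfI n0); rewrite big_mkcond !mulr_sumr.
transitivity (\sum_x gauss_char (box_val x) * chi x).
  by apply: eq_bigr => x _; rewrite chiE; case: ifP; rewrite ?mulr0 // mulrC.
under eq_bigr do rewrite mulr_sumr.
rewrite exchange_big /=.
rewrite -mulr_sumr -[n]sum1_card natr_sum mulr_suml.
apply: eq_big => y; first by rewrite inE.
(* Shifting x by y in K changes (x, x) by 2 (x, y) + (y, y), where (y, y) is 0 modulo 2 m; this
   produces exactly the character term. *)
move/asboolP=> Ky; rewrite mul1r [RHS](reindex_inj (addIr y)) /=.
apply: eq_bigr => x _; rewrite -{2}(box_valK y).
have [z ->] := box_valD x (box_val y).
rewrite gauss_char_periodic /gauss_char diag_sqrD !expfzDr //.
by rewrite [X in _ = _ * X * _]expw_mod ?mulr1 //; apply: K_even.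
Qed.

End BoxSums.

Lemma lat_form_zmod_morphism (L : integral_lattice) (x : L) :
  zmod_morphism (lat_form x).
Proof.
move=> y z; rewrite !(lat_formC x).
by apply/eqP; rewrite eq_sym subr_eq -lat_formDl subrK.
Qed.

HB.instance Definition _ (L : integral_lattice) (x : L) :=
  GRing.isZmodMorphism.Build L int (lat_form x) (lat_form_zmod_morphism x).

Lemma lat_formBl (L : integral_lattice) (x y z : L) :
  lat_form (x - y) z = lat_form x z - lat_form y z.
Proof. by rewrite lat_formC lat_form_zmod_morphism !(lat_formC z). Qed.

Lemma lat_formMzr (L : integral_lattice) (x y : L) (z : int) :
  lat_form x (y *~ z) = lat_form x y * z.
Proof. by rewrite raddfMz mulrzz. Qed.

Lemma lat_formMzl (L : integral_lattice) (x y : L) (z : int) :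
  lat_form (x *~ z) y = lat_form x y * z.
Proof. by rewrite lat_formC lat_formMzr lat_formC. Qed.

Lemma lat_form_suml (L : integral_lattice) (I : finType) (F : I -> L) y :
  lat_form (\sum_i F i) y = \sum_i lat_form (F i) y.
Proof.
by rewrite lat_formC raddf_sum; apply: eq_bigr => i _; rewrite lat_formC.
Qed.

(* K is even for the form (.,.)/g, with dual lattice D. The two cases of
   interest are g = 1, K = D = L, and g = 2, K = M, D = N. An element x of D is
   given by its coordinates (x, e_i)/g in the basis dual to the e_i. *)
Section LatticeGaussSum.
Variables (R : realType) (L : integral_lattice) (g : nat).
Variables (K D : zmodClosed L) (k : nat) (e : 'I_k -> L) (d : 'I_k -> nat).
Hypothesis g_gt0 : (0 < g)%N.
Hypothesis K_sub_D : forall x, x \in K -> x \in D.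
Hypothesis eK : forall i, e i \in K.
Hypothesis e_orth : forall i j, i != j -> lat_form (e i) (e j) = 0.
Hypothesis e_sqr : forall i, lat_form (e i) (e i) = (g * d i)%N%:Z.
Hypothesis d_gt0 : forall i, (0 < d i)%N.
Hypothesis d_even : forall i, ~~ odd (d i).
Hypothesis form_DK : forall x y, x \in D -> y \in K -> (g%:Z %| lat_form x y)%Z.
Hypothesis form_DD : forall x, x \in D -> (g%:Z %| lat_form x x)%Z.
Hypothesis form_KK : forall x, x \in K -> ((2 * g)%N%:Z %| lat_form x x)%Z.
Hypothesis e_complete :
  forall x, x \in D -> (forall i, lat_form x (e i) = 0) -> x = 0.
Hypothesis KD_dual : forall phi : L -> int,
  {in K &, {morph phi : x y / x + y}} ->
  exists2 l, l \in D & {in K, forall y, lat_form l y = g%:Z * phi y}.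

(** The factor 2 keeps m > 1 also for k = 0, as ['Z_m] requires. *)
Let m := (2 * \prod_i d i)%N.
Let t i := (m %/ d i)%N.

Let m_gt1 : (1 < m)%N.
Proof.
have : (0 < \prod_i d i)%N by rewrite prodn_gt0.
by rewrite /m; lia.
Qed.

Let tdm i : (t i * d i)%N = m.
Proof. by rewrite /t divnK // /m dvdn_mull // (bigD1 i) //= dvdn_mulr. Qed.

Let g0 : g%:Z != 0. Proof. by rewrite eqz_nat -lt0n. Qed.

Let m0 : m%:Z != 0. Proof. by rewrite eqz_nat -lt0n ltnW. Qed.

Let c (x : L) : {ffun 'I_k -> int} := [ffun i => (lat_form x (e i) %/ g%:Z)%Z].

Let cE x i : x \in D -> lat_form x (e i) = c x i * g%:Z.
Proof. by move=> xD; rewrite ffunE divzK // form_DK. Qed.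

Let cB : {in D &, {morph c : x y / x - y}}.
Proof.
move=> x y xD yD; apply/ffunP => i; apply: (mulIf g0).
rewrite -cE ?rpredB // !ffunE lat_formBl mulrBl.
by rewrite !divzK ?form_DK.
Qed.

Let cD : {in D &, {morph c : x y / x + y}}.
Proof.
move=> x y xD yD; apply/ffunP => i; apply: (mulIf g0).
rewrite -cE ?rpredD // !ffunE lat_formDl mulrDl.
by rewrite !divzK ?form_DK.
Qed.

Let c_e i j : c (e i) j = (d i)%:Z *+ (i == j).
Proof.
rewrite ffunE; have [<-|/e_orth ->] := eqVneq; last by rewrite div0z.
by rewrite e_sqr PoszM mulrC mulzK.
Qed.

(** The orthogonal expansion x = sum_i (c_i / d_i) e_i with denominators cleared by m = t_i d_i. *)
Let expand x : x \in D -> x *~ m = \sum_i e i *~ ((t i)%:Z * c x i).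
Proof.
move=> xD; apply/eqP; rewrite -subr_eq0; apply/eqP; apply: e_complete.
  rewrite rpredB ?rpredMz ?rpred_sum // => i _; exact/rpredMz/K_sub_D.
move=> j; rewrite lat_formBl lat_form_suml (bigD1 j) //= big1 => [|i ij].
  rewrite addr0 !lat_formMzl cE // e_sqr -(tdm j) !PoszM.
  by ring.
by rewrite lat_formMzl e_orth ?mul0r.
Qed.

Let parseval x y : x \in D -> y \in D ->
  lat_form x y * m = g%:Z * diag_form t (c x) (c y).
Proof.
move=> xD yD; rewrite -lat_formMzl expand // lat_form_suml mulr_sumr.
apply: eq_bigr => i _; rewrite lat_formMzl (lat_formC (e i)) cE //.
by ring.
Qed.

Let c_inj : {in D &, injective c}.
Proof.
move=> x y xD yD cxy; apply/eqP; rewrite -subr_eq0; apply/eqP.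
apply: e_complete => [|i]; first exact: rpredB.
by rewrite cE ?rpredB // cB // cxy subrr ffunE mul0r.
Qed.

Let Kc y := exists2 l, l \in K & c l = y.
Let Dc y := exists2 l, l \in D & c l = y.

Let KcB x y : Kc x -> Kc y -> Kc (x - y).
Proof.
case=> [a aK <-] [b bK <-]; exists (a - b); first exact: rpredB.
by rewrite cB ?K_sub_D.
Qed.

(** These are the coordinates of sum_i t_i z_i e_i, which lies in K because the e_i do; hence K can
    be read modulo m. *)
Let Kcm z : Kc (z *+ m).
Proof.
have SK : \sum_i e i *~ ((t i)%:Z * z i) \in K.
  by apply: rpred_sum => i _; apply: rpredMz.
exists (\sum_i e i *~ ((t i)%:Z * z i)) => //.
apply/ffunP => j; apply: (mulIf g0); rewrite -cE ?K_sub_D //.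
rewrite lat_form_suml (bigD1 j) //= big1 => [|i ij]; last first.
  by rewrite lat_formMzl e_orth ?mul0r.
rewrite addr0 lat_formMzl e_sqr ffun_mulrnE -(tdm j) !PoszM.
by ring.
Qed.

Let Kc_even y : Kc y -> ((2 * m)%N%:Z %| diag_form t y y)%Z.
Proof.
case=> l lK <-; have lD := K_sub_D lK.
have /dvdzP[a aE] := form_KK lK; apply/dvdzP; exists a.
apply: (mulfI g0); rewrite -parseval // aE !PoszM.
by ring.
Qed.

Let diag_form_e x i : diag_form t x (c (e i)) = x i * m%:Z.
Proof.
rewrite /diag_form (bigD1 i) //= big1 => [|j ji]; last first.
  by rewrite c_e eq_sym (negPf ji) mulr0.
by rewrite c_e eqxx addr0 -(tdm i) PoszM mulr1n; ring.
Qed.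

(** For the converse, pairing with x is an integral functional on K, which [KD_dual] represents by
    some l in D; testing against the e_i shows that l has coordinates x. *)
Let DcP x : Dc x <-> forall y, Kc y -> (m%:Z %| diag_form t x y)%Z.
Proof.
split=> [[l lD <-] _ [y yK <-]|xK].
  have /dvdzP[a aE] := form_DK lD yK; apply/dvdzP; exists a.
  by apply: (mulfI g0); rewrite -parseval ?(K_sub_D yK) // aE; ring.
have dv y : y \in K -> (m%:Z %| diag_form t x (c y))%Z.
  by move=> yK; apply: xK; exists y.
have [|l lD lE] := @KD_dual (fun y => diag_form t x (c y) %/ m%:Z)%Z.
  move=> y z yK zK; apply: (mulIf m0).
  by rewrite mulrDl !divzK ?dv ?rpredD // cD ?K_sub_D // diag_formDr.
exists l => //; apply/ffunP => i; apply: (mulIf g0).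
by rewrite -cE // lE // diag_form_e mulzK // mulrC.
Qed.

Let form_half x : x \in D ->
  gauss_char R m t (c x) = (-1) ^ (lat_form x x %/ g%:Z)%Z.
Proof.
move=> xD; rewrite /gauss_char.
have -> : diag_form t (c x) (c x) = m%:Z * (lat_form x x %/ g%:Z)%Z.
  apply: (mulfI g0); rewrite -parseval // mulrCA [g%:Z * _]mulrC.
  by rewrite divzK ?form_DD // mulrC.
rewrite -exprz_exp -exprnP cisMn -[_ *+ _]mulr_natr divfK ?cis_pi //.
by rewrite pnatr_eq0 -lt0n ltnW.
Qed.

(** A list meeting each class of D modulo K the same number n > 0 of times serves in place of a sum
    over D / K: its sign sum is n times the true one. *)
Lemma lattice_gauss_sum :
  exists us : seq L, [/\ {subset us <= D},
    exists2 n, (0 < n)%N & {in D, forall x, count (fun u => u - x \in K) us = n}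
  & exists2 p : R[i], 0 < p &
    \sum_(u <- us) (-1) ^ (lat_form u u %/ g%:Z)%Z = p * cis (pi / 4) ^+ k].
Proof.
pose B := [pred x : {ffun 'I_k -> 'Z_m} | `[< Dc (box_val x) >]].
have /choice[l lP] : forall x : {ffun 'I_k -> 'Z_m}, exists l,
    x \in B -> l \in D /\ c l = box_val x.
  move=> x; have [/asboolP[l lD lE]|] := boolP (x \in B); first by exists l.
  by exists 0.
exists [seq l x | x in B]; split.
- by move=> _ /mapP[x xB ->]; rewrite mem_enum in xB; case: (lP x xB).
- exists #|[pred x : {ffun 'I_k -> 'Z_m} | `[< Kc (box_val x) >]]|.
    exact: box_sublattice_card_gt0.
  move=> x0 x0D; rewrite -(box_sublattice_card m_gt1 KcB Kcm (c x0)).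
  rewrite count_map -size_filter cardE /enum_mem -!filter_predI.
  congr size; apply: eq_filter => x /=.
  apply/andP/asboolP => [[]|[y yK yE]].
    move=> + xB; have [xD <-] := lP _ xB.
    by move=> yK; exists (l x - x0); rewrite ?cB.
  have yD := K_sub_D yK.
  have xB : x \in B.
    by apply/asboolP; exists (y + x0); rewrite ?rpredD // cD // yE subrK.
  have [xD lE] := lP _ xB; split=> //.
  rewrite (_ : l x - x0 = y) //; apply: c_inj; rewrite ?rpredB //.
  by rewrite cB // lE yE.
have [p p0 pE] := gauss_sum_box R m_gt1 tdm d_even; exists p => //.
rewrite -pE -(gauss_sum_dual R m_gt1 tdm d_even KcB Kcm Kc_even DcP).
rewrite big_map big_enum; apply: eq_bigr => x /lP[xD xE].
by rewrite -form_half // xE.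
Qed.

End LatticeGaussSum.

(** * Lattices *)

Lemma rat_row_denominator n (u : 'rV[rat]_n) :
  exists2 D : int, D != 0 & exists z : 'rV[int]_n, map_mx intr z = D%:~R *: u.
Proof.
exists (\prod_i denq (u 0 i)).
  by apply/prodf_neq0 => i _; exact: denq_neq0.
exists (\row_i (numq (u 0 i) * \prod_(j | j != i) denq (u 0 j))).
apply/rowP => i; rewrite !mxE [in RHS](bigD1 i) //= !intrM.
rewrite -[X in _ = _ * X](divq_num_den (u 0 i)).
by field; rewrite intr_eq0 denq_neq0.
Qed.

Section Duality.
Variable L : integral_lattice.

Let gram : 'M[rat]_(lat_rank L) :=
  \matrix_(i, j) (@lat_form L (lat_basis i) (lat_basis j))%:~R.

Let lat_formQE (x y : lat_Q L) : lat_formQ x y = (x *m gram *m y^T) 0 0.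
Proof.
rewrite /lat_formQ mxE exchange_big; apply: eq_bigr => j _.
rewrite !mxE mulr_suml.
by apply: eq_bigr => i _; rewrite !mxE mulrAC.
Qed.

Lemma lat_formQ_suml n (a : 'I_n -> rat) (X : 'I_n -> lat_Q L) y :
  lat_formQ (\sum_i a i *: X i) y = \sum_i a i * lat_formQ (X i) y.
Proof.
rewrite lat_formQE !mulmx_suml summxE; apply: eq_bigr => i _.
by rewrite lat_formQE -!scalemxAl mxE.
Qed.

Lemma lat_embD (x y : L) : lat_emb (x + y) = lat_emb x + lat_emb y.
Proof. by rewrite -[in RHS](addrK y x) lat_embB subrK. Qed.

Lemma lat_form_coord (x y : L) :
  lat_form x y = \sum_i lat_coord x 0 i * lat_form (lat_basis i) y.
Proof.
rewrite {1}(lat_coordP x) lat_form_suml.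
by apply: eq_bigr => i _; rewrite lat_formMzl mulrC.
Qed.

Lemma lat_formQ_emb (x y : L) :
  lat_formQ (lat_emb x) (lat_emb y) = (lat_form x y)%:~R.
Proof.
rewrite lat_form_coord rmorph_sum; apply: eq_bigr => i _.
rewrite lat_formC lat_form_coord rmorphM rmorph_sum mulr_sumr.
by apply: eq_bigr => j _; rewrite !mxE lat_formC rmorphM mulrA.
Qed.

Lemma lat_coord_eq (x : L) (c : 'rV[int]_(lat_rank L)) :
  x = \sum_i lat_basis i *~ c 0 i -> lat_coord x = c.
Proof.
have [_ /(_ x I) [c' [_ uc]]] := lat_basisP L => /uc <-.
exact/esym/uc/lat_coordP.
Qed.

(** A rational kernel vector, cleared of denominators, gives a lattice vector in the radical of the
    form. *)
Let gram_unit : gram \in unitmx.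
Proof.
rewrite -row_free_unit; apply: inj_row_free => u uG.
have [D D0 [z zE]] := rat_row_denominator u.
pose x := \sum_i lat_basis i *~ z 0 i.
have xz : lat_coord x = z by apply: lat_coord_eq.
suff x0 : x = 0.
  move: zE; rewrite -xz x0 -(subrr 0) lat_coordB subrr map_mx0.
  by move/esym/eqP; rewrite scaler_eq0 intr_eq0 (negPf D0) => /eqP.
apply: lat_form_nondeg => y; apply: (intr_inj (R := rat)).
rewrite -lat_formQ_emb lat_formQE /lat_emb xz zE.
by rewrite -!scalemxAl uG !mul0mx scaler0 mxE.
Qed.

(** The inverse Gram matrix represents phi by a rational vector; it pairs integrally with L, so it
    lies in the dual lattice, which is L. *)
Lemma self_dual_represents (phi : L -> int) :
  is_self_dual L -> {morph phi : x y / x + y} ->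
  exists l, forall y, lat_form l y = phi y.
Proof.
move=> Ldual phiD.
have phi0 : phi 0 = 0 by apply: (addrI (phi 0)); rewrite -phiD !addr0.
have phiM x (z : int) : phi (x *~ z) = phi x * z.
  have phiN y : phi (- y) = - phi y.
    by apply: (addrI (phi y)); rewrite -phiD !subrr.
  have phin n : phi (x *+ n) = phi x *+ n.
    by elim: n => // n IHn; rewrite !mulrS phiD IHn.
  rewrite -mulrzz; case: z => n.
    by rewrite -?pmulrn phin.
  by rewrite -?pmulrn ?NegzE ?mulrNz -?pmulrn ?phiN phin.
have phi_coord y : phi y = \sum_i lat_coord y 0 i * phi (lat_basis i).
  rewrite {1}(lat_coordP y) (big_morph phi phiD phi0).
  by apply: eq_bigr => i _; rewrite phiM mulrC.
pose p : lat_Q L := \row_i (phi (lat_basis i))%:~R.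
pose v : lat_Q L := p *m invmx gram.
have vE y : lat_formQ v (lat_emb y) = (phi y)%:~R.
  rewrite lat_formQE mulmxKV // mxE phi_coord rmorph_sum.
  by apply: eq_bigr => i _; rewrite !mxE rmorphM mulrC.
have [l _ lv] : range (@lat_emb L) v.
  by rewrite Ldual => y; rewrite vE; apply: intr_int.
exists l => y; apply: (intr_inj (R := rat)).
by rewrite -lat_formQ_emb lv vE.
Qed.

End Duality.

(** * The involution and orthogonal families *)

Section Involution.
Variables (L : integral_lattice) (s : {additive L -> L}).
Hypotheses (s_aut : is_automorphism s) (s_inv : forall x, s (s x) = x).
Hypothesis Lpos : is_positive_definite L.

Lemma lat_form_invol x y : lat_form (s x) y = lat_form x (s y).
Proof. by rewrite -[in LHS](s_inv y) s_aut.2. Qed.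

Lemma lat_torsion_free (x : L) : x + x = 0 -> x = 0.
Proof.
move=> xx; apply/eqP/contraT => x0; have := Lpos x0.
have : lat_form (x + x) x = 0 by rewrite xx lat_formC raddf0.
by rewrite lat_formDl; lia.
Qed.

Lemma latM_neg x : x \in latM s -> s x = - x.
Proof. by case/asboolP => y ->; rewrite raddfB s_inv opprB. Qed.

(** If s x = -x, then 2 x = (1 - s) x is in M. Conversely M, hence its rational span, is orthogonal
    to every b + s b, so x + s x is in the radical. *)
Lemma latNP x : (x \in latN s) = (s x == - x).
Proof.
apply/idP/eqP => [/asboolP[us [usM xus]]|sx]; last first.
  apply/asboolP; exists [:: x + x]; split=> [y|].
    by rewrite inE => /eqP->; apply/asboolP; exists x; rewrite sx opprK.
  have -> : lat_emb x = 2^-1 *: lat_emb (x + x).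
    by rewrite lat_embD -mulr2n -scaler_nat scalerA mulVf // scale1r.
  by rewrite memvZ // memv_span //= inE.
apply/eqP; rewrite -addr_eq0 addrC; apply/eqP; apply: lat_form_nondeg => b.
rewrite lat_formDl lat_form_invol -raddfD /=; set c := b + s b.
have cM y : y \in latM s -> lat_form y c = 0.
  move=> /latM_neg sy; rewrite raddfD /= -lat_form_invol sy.
  by rewrite -[- y]sub0r lat_formBl (lat_formC 0) raddf0 sub0r addrN.
apply: (intr_inj (R := rat)); rewrite -lat_formQ_emb.
have X : lat_emb x \in <<in_tuple [seq lat_emb u | u <- us]>>%VS by [].
rewrite (coord_span X) lat_formQ_suml big1 // => i _.
have /mapP[u uus ->] : (in_tuple [seq lat_emb u | u <- us])`_i
  \in [seq lat_emb u | u <- us] by apply: mem_nth.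
by rewrite lat_formQ_emb cM ?mulr0 //; apply: usM.
Qed.


Definition orthogonal_family (P : {pred L}) k (e : 'I_k -> L) :=
  [/\ forall i, e i \in P, forall i, e i != 0
    & forall i j, i != j -> lat_form (e i) (e j) = 0].

(** The Gram matrix of the family is diagonal and invertible, and it factors through a space of
    dimension n. *)
Lemma orthogonal_family_le (P : {pred L}) k (e : 'I_k -> L) n (b : 'I_n -> L) :
    orthogonal_family P e ->
    (forall i, exists c : 'rV[int]_n, e i = \sum_j b j *~ c 0 j) ->
  (k <= n)%N.
Proof.
move=> [_ e0 eo] /choice[c cE].
pose C : 'M[rat]_(k, n) := \matrix_(i, j) (c i 0 j)%:~R.
pose B : 'M[rat]_(n, k) := \matrix_(j, i) (lat_form (b j) (e i))%:~R.
have CB : C *m B = diag_mx (\row_i (lat_form (e i) (e i))%:~R).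
  apply/matrixP => i j; rewrite !mxE.
  transitivity ((lat_form (e i) (e j))%:~R : rat).
    rewrite (cE i) lat_form_suml rmorph_sum; apply: eq_bigr => l _.
    by rewrite !mxE lat_formMzl rmorphM mulrC.
  have [->|ij] := eqVneq i j; first by [].
  by rewrite eo.
have : diag_mx (\row_i (lat_form (e i) (e i))%:~R : 'rV[rat]_k) \in unitmx.
  rewrite unitmxE det_diag unitfE; apply/prodf_neq0 => i _.
  by rewrite mxE intr_eq0 gt_eqF // Lpos.
rewrite -row_free_unit -CB => /eqP <-.
by apply: leq_trans (mxrankM_maxl _ _) (rank_leq_col _).
Qed.

(** Replaces a Z-basis of P. The rank of L bounds the length, and a nonzero vector of P orthogonal
    to a longest family would extend it. *)
Lemma maximal_orthogonal_family (P : {pred L}) :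
  exists k (e : 'I_k -> L), orthogonal_family P e /\
    (forall x, x \in P -> (forall i, lat_form x (e i) = 0) -> x = 0).
Proof.
pose A k := `[< exists e : 'I_k -> L, orthogonal_family P e >].
have A0 : exists k, A k.
  by exists 0%N; apply/asboolP; exists (fun=> 0); split=> -[].
have Ale k : A k -> (k <= lat_rank L)%N.
  move=> /asboolP[e eP]; apply: (orthogonal_family_le (b := @lat_basis L) eP).
  by move=> i; exists (lat_coord (e i)); apply: lat_coordP.
case: (ex_maxnP A0 Ale) => k /asboolP[e eP] kmax.
exists k, e; split=> // x xP xe.
apply/eqP/contraT => x0; have := kmax k.+1; rewrite ltnn; apply.
apply/asboolP; exists (fun i => oapp e x (unlift ord0 i)).
case: eP => eP e0 eo; split=> [i|i|i j].
- by case: unliftP => [j|] _ /=.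
- by case: unliftP => [j|] _ /=.
- case: unliftP => [i'|] ->; case: unliftP => [j'|] -> //=.
  + by rewrite (inj_eq lift_inj) => /eo.
  + by rewrite lat_formC xe.
Qed.

Lemma orthogonal_family_sqr_gt0 (P : {pred L}) k (e : 'I_k -> L) i :
  orthogonal_family P e -> 0 < lat_form (e i) (e i).
Proof. by case=> _ e0 _; apply: Lpos. Qed.

(** For r <= k: with D the product of the norms, each D b_j is an integral combination of the e_i,
    so the scalar matrix D of size r factors through dimension k. *)
Lemma maximal_orthogonal_family_rank (P : zmodClosed L) k (e : 'I_k -> L) r :
    orthogonal_family P e ->
    (forall x, x \in P -> (forall i, lat_form x (e i) = 0) -> x = 0) ->
    has_rank [set` P] r ->
  k = r.
Proof.
move=> eorth emax [b [bP bU]]; have [eP e0 eo] := eorth.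
apply/eqP; rewrite eqn_leq; apply/andP; split.
  apply: (orthogonal_family_le (b := b) eorth) => i.
  by have [c [cE _]] := bU _ (eP i); exists c.
pose D := \prod_i lat_form (e i) (e i).
have D0 : D != 0.
  apply/prodf_neq0 => i _.
  by rewrite gt_eqF // (orthogonal_family_sqr_gt0 i eorth).
pose B j i := lat_form (b j) (e i) * \prod_(l | l != i) lat_form (e l) (e l).
have DB j : b j *~ D = \sum_i e i *~ B j i.
  apply/eqP; rewrite -subr_eq0; apply/eqP; apply: emax.
    rewrite rpredB ?rpredMz ?rpred_sum //; first exact: bP.
    by move=> i _; rewrite rpredMz.
  move=> i; rewrite lat_formBl lat_formMzl lat_form_suml (bigD1 i) //= big1.
    by rewrite addr0 lat_formMzl /B /D [in X in X - _](bigD1 i) //=; ring.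
  by move=> l li; rewrite lat_formMzl eo ?mul0r.
have /choice[C CE] : forall i, exists c : 'rV[int]_r, e i = \sum_j b j *~ c 0 j.
  by move=> i; have [c [cE _]] := bU _ (eP i); exists c.
have BC : (\matrix_(j, i) (B j i)%:~R : 'M[rat]_(r, k)) *m
    (\matrix_(i, l) (C i 0 l)%:~R) = D%:~R%:M.
  apply/matrixP => j l; rewrite !mxE.
  have [c [cE cU]] := bU (b j *~ D) (rpredMz D (bP j)).
  have c1 : c = \row_l (D *+ (j == l)).
    apply: cU; rewrite (bigD1 j) //= big1 => [|i ij]; rewrite !mxE ?eqxx.
      by rewrite addr0.
    by rewrite eq_sym (negPf ij) mulr0z.
  have c2 : c = \row_l \sum_i B j i * C i 0 l.
    apply: cU; rewrite DB; under eq_bigr do rewrite {1}CE mulrz_suml.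
    rewrite exchange_big; apply: eq_bigr => i _; rewrite mxE.
    by rewrite mulrz_sumr; apply: eq_bigr => i' _; rewrite -mulrzA mulrC.
  transitivity ((c 0 l)%:~R : rat).
    rewrite c2 mxE rmorph_sum; apply: eq_bigr => i _.
    by rewrite !mxE rmorphM.
  by rewrite c1 mxE rmorphMn.
have : row_free (D%:~R%:M : 'M[rat]_r).
  by rewrite row_free_unit unitmxE det_scalar unitfE expf_neq0 // intr_eq0.
rewrite -BC => /eqP <-.
by apply: leq_trans (mxrankM_maxl _ _) (rank_leq_col _).
Qed.

End Involution.

(** As z^4 = -1, positivity of z^(4 j) forces j even; this is applied to j = k, k / 2 and k / 4. *)
Lemma cis_pi4_pow_dvd8 (R : realType) k :
  0 < (cis (pi / 4) : R[i]) ^+ k -> (8 %| k)%N.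
Proof.
set z := cis (pi / 4); move=> zk.
have z4 : z ^+ 4 = -1.
  by rewrite cisMn -[_ *+ _]mulr_natr divfK ?pnatr_eq0 // cis_pi.
have even j : 0 < z ^+ (4 * j) -> ~~ odd j.
  by rewrite exprM z4 -signr_odd; case: odd => //; rewrite expr1 oppr_gt0 ltr10.
have /even_halfK k1 : ~~ odd k by apply: even; rewrite mulnC exprM exprn_gt0.
have /even_halfK k2 : ~~ odd k./2.
  apply: even; rewrite (_ : (4 * k./2)%N = (k * 2)%N); last by lia.
  by rewrite exprM exprn_gt0.
have /even_halfK k4 : ~~ odd k./2./2.
  by apply: even; rewrite (_ : (4 * k./2./2)%N = k) //; lia.
by apply/dvdnP; exists k./2./2./2; lia.
Qed.

Definition latT (L : integral_lattice) : {pred L} := fun=> true.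

Lemma latT_zmod_closed (L : integral_lattice) : zmod_closed (@latT L).
Proof. by []. Qed.

HB.instance Definition _ (L : integral_lattice) :=
  GRing.isZmodClosed.Build L (@latT L) (latT_zmod_closed L).

Lemma dvdz_even_half (a : int) (g : nat) : (0 < g)%N -> 0 < a ->
  ((2 * g)%N%:Z %| a)%Z ->
  exists d : nat, [/\ (0 < d)%N, ~~ odd d & a = (g * d)%N%:Z].
Proof.
move=> g0 a0 /dvdzP[[b|b] E]; rewrite {a}E in a0 *; last first.
  by rewrite pmulr_lgt0 // ltz_nat muln_gt0 in a0.
case: b a0 => [|b] a0; first by rewrite mul0r in a0.
exists (b.+1 * 2)%N; split; rewrite ?oddM ?andbF //.
by rewrite -PoszM; congr Posz; ring.
Qed.

(** * Positivity of the Gauss sum of N/M *)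

Section Unimodular.
Variables (R : realType) (L : integral_lattice).
Hypotheses (Lpos : is_positive_definite L) (Leven : is_even L).
Hypothesis Ldual : is_self_dual L.

Lemma even_unimodular_rank k (e : 'I_k -> L) :
    orthogonal_family (@latT L) e ->
    (forall x, (forall i, lat_form x (e i) = 0) -> x = 0) ->
  (8 %| k)%N.
Proof.
move=> eorth ecompl; have [_ e0 eo] := eorth.
have /choice[d dP] i : exists d : nat,
    [/\ (0 < d)%N, ~~ odd d & lat_form (e i) (e i) = (1 * d)%N%:Z].
  by apply: dvdz_even_half; rewrite ?Lpos // Leven.
have := @lattice_gauss_sum R L 1 (@latT L) (@latT L) k e d.
case=> [//|//|//|//|i|i|i|x y _ _|x _|x _|x _|phi phiD
       |us [_ [n n0 nE] [p p0 pE]]].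
- by case: (dP i).
- by case: (dP i).
- by case: (dP i).
- exact: dvd1z.
- exact: dvd1z.
- exact: Leven.
- exact: ecompl.
- have [|l lE] := self_dual_represents (phi := phi) Ldual.
    by move=> x y; apply: phiD.
  by exists l => // y _; rewrite mul1r.
apply: (@cis_pi4_pow_dvd8 R); rewrite -(pmulr_rgt0 _ p0) -pE.
rewrite (eq_bigr (fun=> 1)) => [|u _].
  rewrite big_const_seq iter_addr_0 ltr0n (leq_trans n0) // -(nE 0 isT).
  exact: sub_count.
have /dvdzP[a aE] := Leven u.
by rewrite divz1 aE mulrC -exprz_exp -exprnP sqrrN expr1n exp1rz.
Qed.

Variables (s : {additive L -> L}) (r : nat).
Hypotheses (s_aut : is_automorphism s) (s_inv : forall x, s (s x) = x).
Hypothesis s_even : forall a : L, (2 %| lat_form a (s a))%Z.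
Hypotheses (rank_fix : has_rank (fixed_sublattice s) r) (r8 : (8 %| r)%N).

Definition latF : {pred L} := fun x => s x == x.

Lemma latF_zmod_closed : zmod_closed latF.
Proof.
split=> [|x y]; rewrite !unfold_in ?raddf0 // => /eqP sx /eqP sy.
by rewrite raddfB sx sy.
Qed.

HB.instance Definition _ := GRing.isZmodClosed.Build L latF latF_zmod_closed.

Let s_adj := lat_form_invol s_aut s_inv.

Lemma lat_form_fixed_neg x y : x \in latF -> s y = - y -> lat_form x y = 0.
Proof.
move=> /eqP sx sy; have := s_adj x y.
by rewrite sx sy raddfN /=; lia.
Qed.

Lemma lat_form_sub_invol x y :
  s x = - x -> lat_form x (y - s y) = 2 * lat_form x y.
Proof.
move=> sx; rewrite raddfB /= -s_adj sx -[- x]sub0r lat_formBl.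
by rewrite (lat_formC 0) raddf0; ring.
Qed.

(** (y - s y, y - s y) = 2 (y, y) - 2 (y, s y), with both pairings even. *)
Lemma lat_form_latM x : x \in latM s -> (4 %| lat_form x x)%Z.
Proof.
case/asboolP=> y ->; rewrite lat_formBl !raddfB /= !s_adj s_inv.
have /dvdzP[a ->] := Leven y; have /dvdzP[b ->] := s_even y.
by apply/dvdzP; exists (a - b); ring.
Qed.

(* An orthogonal basis of M, together with one of L^s, is one of L. *)
Lemma latM_rank_dvd8 k (e : 'I_k -> L) :
    orthogonal_family (latM s) e ->
    (forall x, x \in latM s -> (forall i, lat_form x (e i) = 0) -> x = 0) ->
  (8 %| k)%N.
Proof.
move=> [eM e0 eo] emax.
have [k' [f [forth fmax]]] := maximal_orthogonal_family Lpos latF.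
have k'r : k' = r.
  apply: (maximal_orthogonal_family_rank Lpos forth fmax).
  suff -> : [set` latF]%classic = fixed_sublattice s by [].
  by apply/seteqP; split=> x /eqP.
rewrite -(dvdn_addr _ (_ : 8 %| k')%N) ?k'r // -k'r.
have [fF f0 fo] := forth.
pose h i := match split i with inl j => f j | inr j => e j end.
have hl i : h (lshift k i) = f i by rewrite /h (unsplitK (inl _ i)).
have hr i : h (rshift k' i) = e i by rewrite /h (unsplitK (inr _ i)).
apply: (@even_unimodular_rank _ h); first split=> //.
- by move=> i; rewrite /h; case: split.
- move=> i j; rewrite -(inj_eq (can_inj splitK)).
  rewrite /h; case: (split i) => i'; case: (split j) => j' ij.
  + by apply: fo; apply: contraNneq ij => ->.
  + by apply: lat_form_fixed_neg => //; apply: latM_neg.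
  + by rewrite lat_formC; apply: lat_form_fixed_neg => //; apply: latM_neg.
  + by apply: eo; apply: contraNneq ij => ->.
move=> x xh.
have xf i : lat_form x (f i) = 0 by rewrite -hl.
have xe i : lat_form x (e i) = 0 by rewrite -hr.
(* The vector x + s x is fixed and orthogonal to all f_i, hence 0; then 2 x = x - s x lies in M and
   is orthogonal to all e_i. *)
have sx : s x = - x.
  apply/eqP; rewrite -addr_eq0 addrC; apply/eqP/fmax => [|i].
    by apply/eqP; rewrite raddfD /= s_inv addrC.
  by rewrite lat_formDl s_adj // (eqP (fF i)) xf.
apply: (lat_torsion_free Lpos); rewrite -{2}[x]opprK -sx.
apply: emax => [|i]; first by apply/asboolP; exists x.
by rewrite lat_formBl s_adj // latM_neg // raddfN /= xe.
Qed.

Lemma latA_gauss_sum_gt0 :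
  exists us : seq L, [/\ {subset us <= latN s},
    exists2 n, (0 < n)%N &
      {in latN s, forall x, count (fun u => u - x \in latM s) us = n}
  & 0 < \sum_(u <- us) (-1) ^ (lat_form u u %/ 2)%Z :> R[i]].
Proof.
have [k [e [eorth emax]]] := maximal_orthogonal_family Lpos (latM s).
have k8 := latM_rank_dvd8 eorth emax; have [eM e0 eo] := eorth.
have /choice[d dP] i : exists d : nat,
    [/\ (0 < d)%N, ~~ odd d & lat_form (e i) (e i) = (2 * d)%N%:Z].
  by apply: dvdz_even_half; rewrite ?Lpos // lat_form_latM.
have sN x : x \in latN s -> s x = - x by rewrite latNP // => /eqP.
have := @lattice_gauss_sum R L 2 (latM s) (latN s) k e d.
case=> [//|||//|i|i|i|x y xN|x _|x xM|x xN xe|phi phiD|us [usN un [p p0 pE]]].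
- exact: latM_subN.
- exact: eM.
- by case: (dP i).
- by case: (dP i).
- by case: (dP i).
- by case/asboolP=> z ->; rewrite lat_form_sub_invol ?sN // dvdz_mulr.
- exact: Leven.
- exact: lat_form_latM.
- apply: (lat_torsion_free Lpos); apply: emax => [|i].
    by apply/asboolP; exists x; rewrite sN ?opprK.
  by rewrite lat_formDl xe.
- have phi0 : phi 0 = 0.
    by apply: (addrI (phi 0)); rewrite -phiD ?rpred0 // !addr0.
  have sM y : y - s y \in latM s by apply/asboolP; exists y.
  (* The pullback of phi along 1 - s changes sign under s, so its representative l satisfies s l =
     -l, that is, l is in N; and (l, y - s y) = 2 (l, y) = 2 phi(y - s y). *)
  have [x y|l lE] := self_dual_represents (phi := fun y => phi (y - s y)) Ldual.
    by rewrite -phiD // raddfD opprD addrACA.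
  have sl : s l = - l.
    apply/eqP; rewrite -addr_eq0; apply/eqP; apply: lat_form_nondeg => y.
    rewrite lat_formDl s_adj // !lE s_inv -phiD //.
      by rewrite -opprB addNr phi0.
    by rewrite -opprB rpredN.
  exists l; first by rewrite latNP // sl.
  by move=> _ /asboolP[y ->]; rewrite lat_form_sub_invol // lE.
exists us; split=> //; rewrite pE mulr_gt0 //.
case/dvdnP: k8 => j ->; rewrite mulnC exprM cisMn.
suff -> : pi / 4 *+ 8 = pi *+ 2 :> R by rewrite /cis cos2pi sin2pi expr1n ltr01.
by rewrite -[_ *+ 8]mulr_natr -[_ *+ 2]mulr_natr; field.
Qed.

End Unimodular.

(** * Representations *)

Section AbstractHeisenberg.
Variables (C : numClosedFieldType) (A : zmodType) (G : groupType).
Variables (pr : G -> A) (V : lmodType C) (rho : G -> {linear V -> V}).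
Variables (eps : A -> C) (en : seq A).

Hypothesis rho1 : forall x, rho 1%g x = x.
Hypothesis rhoM : forall h k x, rho (h * k)%g x = rho h (rho k x).
Hypothesis prM : forall h k, pr (h * k)%g = pr h + pr k.
Hypothesis pr_surj : forall a, exists h, pr h = a.
Hypothesis pr_ker :
  forall h, pr h = 0 -> exists2 c, c != 0 & forall x, rho h x = c *: x.
Hypothesis eps_sqr : forall a, eps a * eps a = 1.
Hypothesis epsN : forall a, eps (- a) = eps a.
(* eps is a quadratic character, with values +1 and -1, whose polarization is
   the commutator form. *)
Hypothesis rho_comm : forall h k x,
  rho (h * k)%g x =
  (eps (pr h + pr k) * eps (pr h) * eps (pr k)) *: rho (k * h)%g x.
Hypothesis V_neq0 : exists x : V, x != 0.
Hypothesis rho_irr : forall W : V -> Prop,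
  (forall c x y, W x -> W y -> W (c *: x + y)) ->
  (forall h x, W x -> W (rho h x)) ->
  forall x0, x0 != 0 -> W x0 -> forall x, W x.
Hypothesis en_uniq : uniq en.
Hypothesis en_all : forall a, a \in en.
Hypothesis eps_sum_gt0 : 0 < \sum_(a <- en) eps a.

Lemma rhoK h x : rho (h^-1)%g (rho h x) = x.
Proof. by rewrite -rhoM mulVg rho1. Qed.

Lemma rhoVK h x : rho h (rho (h^-1)%g x) = x.
Proof. by rewrite -rhoM mulgV rho1. Qed.

Lemma pr1 : pr 1%g = 0.
Proof. by apply: (addrI (pr 1%g)); rewrite -prM mulg1 addr0. Qed.

Lemma prV h : pr (h^-1)%g = - pr h.
Proof. by apply/eqP; rewrite -addr_eq0 -prM mulVg pr1. Qed.

Lemma sum_addl (U : nmodType) (F : A -> U) b :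
  \sum_(a <- en) F (b + a) = \sum_(a <- en) F a.
Proof.
rewrite -(big_map (fun a => b + a) xpredT F); apply/perm_big/uniq_perm => //.
  by rewrite map_inj_uniq //; apply: addrI.
move=> a; rewrite en_all; apply/mapP; exists (a - b) => //.
by rewrite addrC subrK.
Qed.

Lemma sum_opp (U : nmodType) (F : A -> U) :
  \sum_(a <- en) F (- a) = \sum_(a <- en) F a.
Proof.
rewrite -(big_map -%R xpredT F); apply/perm_big/uniq_perm => //.
  by rewrite map_inj_uniq //; apply: oppr_inj.
by move=> a; rewrite en_all; apply/mapP; exists (- a); rewrite ?opprK.
Qed.

Lemma rho_class h k : pr h = pr k ->
  exists2 c, c != 0 & forall x, rho h x = c *: rho k x /\
    rho (h^-1)%g x = c^-1 *: rho (k^-1)%g x.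
Proof.
move=> hk; have [|c c0 cE] := pr_ker (h := (h * k^-1)%g).
  by rewrite prM prV hk subrr.
have hE x : rho h x = c *: rho k x by rewrite -cE rhoM rhoK.
exists c => // x; split=> //; rewrite -{2}(rhoVK h x) hE linearZ /= rhoK.
by rewrite scalerA mulVf // scale1r.
Qed.

Definition class_fun (U : Type) (F : G -> U) :=
  forall h k, pr h = pr k -> F h = F k.

Lemma scalar0 (lam : V -> C) : scalar lam -> lam 0 = 0.
Proof.
move=> lamL; have := lamL 1 0 0; rewrite scaler0 addr0 mul1r -[LHS]addr0.
by move/addrI.
Qed.

Lemma scalarZ (lam : V -> C) c x : scalar lam -> lam (c *: x) = c * lam x.
Proof.
by move=> lamL; have := lamL c x 0; rewrite addr0 scalar0 // addr0.
Qed.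

Lemma class_fun_tensor (lam mu : V -> C) x y : scalar lam -> scalar mu ->
  class_fun (fun h => lam (rho h x) * mu (rho (h^-1)%g y)).
Proof.
move=> lamL muL h k /rho_class[c c0 cE].
have [-> _] := cE x; have [_ ->] := cE y.
by rewrite !scalarZ // mulrACA mulfV // mul1r.
Qed.

Lemma class_fun_tensorV (lam : V -> C) x y : scalar lam ->
  class_fun (fun h => lam (rho (h^-1)%g y) *: rho h x).
Proof.
move=> lamL h k /rho_class[c c0 cE].
have [-> _] := cE x; have [_ ->] := cE y.
by rewrite scalarZ // scalerA mulrAC mulVf // mul1r.
Qed.

Definition sec a : G := projT1 (cid (pr_surj a)).

Lemma secK a : pr (sec a) = a. Proof. by rewrite /sec; case: cid. Qed.

Lemma sum_class_funMl (U : nmodType) (F : G -> U) k : class_fun F ->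
  \sum_(a <- en) F (k * sec a)%g = \sum_(a <- en) F (sec a).
Proof.
move=> Fc; rewrite -[RHS](sum_addl _ (pr k)); apply: eq_bigr => a _.
by apply: Fc; rewrite prM !secK.
Qed.

Lemma sum_class_funMr (U : nmodType) (F : G -> U) k : class_fun F ->
  \sum_(a <- en) F (sec a * k)%g = \sum_(a <- en) F (sec a).
Proof.
move=> Fc; rewrite -[RHS](sum_addl _ (pr k)); apply: eq_bigr => a _.
by apply: Fc; rewrite prM !secK addrC.
Qed.

Lemma sum_class_funV (U : nmodType) (F : G -> U) : class_fun F ->
  \sum_(a <- en) F ((sec a)^-1)%g = \sum_(a <- en) F (sec a).
Proof.
move=> Fc; rewrite -[RHS]sum_opp; apply: eq_bigr => a _.
by apply: Fc; rewrite prV !secK.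
Qed.

Lemma scalar_sum (lam : V -> C) I (r : seq I) (F : I -> C) (x : I -> V) :
  scalar lam -> lam (\sum_(i <- r) F i *: x i) = \sum_(i <- r) F i * lam (x i).
Proof.
move=> lamL; elim: r => [|i r IHr]; first by rewrite !big_nil scalar0.
by rewrite !big_cons lamL IHr.
Qed.

Definition dual_basis d (e : 'I_d -> V) (lam : 'I_d -> V -> C) :=
  [/\ forall i, scalar (lam i), forall x, x = \sum_i lam i x *: e i
    & forall i j, lam i (e j) = (i == j)%:R].

Lemma minimal_spanning_dual_basis d (e : 'I_d -> V) :
    (forall x, exists c : 'I_d -> C, x = \sum_i c i *: e i) ->
    (forall n (e' : 'I_n -> V),
      (forall x, exists c : 'I_n -> C, x = \sum_i c i *: e' i) -> (d <= n)%N) ->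
  exists lam, dual_basis e lam.
Proof.
move=> espan emin.
have free (c : 'I_d -> C) : \sum_i c i *: e i = 0 -> forall i, c i = 0.
  move=> c0 j; apply/eqP/contraT => cj.
  case: d e espan emin c c0 j cj => [|d] e espan emin c c0 j cj.
    by case: j cj.
  have := emin d (fun i => e (lift j i)); rewrite ltnn; apply=> x.
  have [b ->] := espan x.
  have ej : e j = \sum_i (- (c j)^-1 * c (lift j i)) *: e (lift j i).
    apply: (scalerI cj); move/eqP: c0; rewrite (bigD1_ord j) //= addr_eq0.
    move/eqP->; rewrite -sumrN scaler_sumr; apply: eq_bigr => i _.
    by rewrite scalerA mulrA mulrN mulfV // mulN1r scaleNr.
  exists (fun i => b (lift j i) - b j * (c j)^-1 * c (lift j i)).
  rewrite (bigD1_ord j) //= {1}ej scaler_sumr -big_split; apply: eq_bigr => i _.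
  by rewrite /= scalerA -scalerDl; congr (_ *: _); ring.
have inj (b c : 'I_d -> C) :
    \sum_i b i *: e i = \sum_i c i *: e i -> forall i, b i = c i.
  move=> bc i; apply/eqP; rewrite -subr_eq0; apply/eqP; move: i; apply: free.
  by under eq_bigr do rewrite scalerBl; rewrite sumrB bc subrr.
have /choice[l lE] := espan; exists (fun i x => l x i); split=> //.
- move=> i c x y; move: i; apply: inj; rewrite -lE {1}(lE x) {1}(lE y).
  rewrite scaler_sumr -big_split; apply: eq_bigr => i _.
  by rewrite /= scalerA -scalerDl.
- move=> i j; move: i; apply: (inj _ (fun i => (i == j)%:R)); rewrite -lE.
  rewrite (bigD1 j) //= eqxx scale1r big1 ?addr0 // => i /negPf->.
  by rewrite scale0r.
Qed.

Lemma rho_sec_mul k a x :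
  exists2 c, c != 0 & rho k (rho (sec a) x) = c *: rho (sec (pr k + a)) x.
Proof.
have [|c c0 cE] := @rho_class (k * sec a)%g (sec (pr k + a)).
  by rewrite prM !secK.
by exists c => //; rewrite -rhoM; case: (cE x).
Qed.

(** The translates of one nonzero vector by representatives of the finite group A span a submodule,
    hence all of V. *)
Lemma exists_dual_basis : exists d (e : 'I_d -> V) lam, dual_basis e lam.
Proof.
pose spans n := `[< exists e : 'I_n -> V,
  forall x, exists c : 'I_n -> C, x = \sum_i c i *: e i >].
have [x0 x00] := V_neq0.
have span0 : exists n, spans n.
  exists (size en); apply/asboolP; exists (fun i => rho (sec (nth 0 en i)) x0).
  pose W x := exists c : A -> C, x = \sum_(a <- en) c a *: rho (sec a) x0.
  have WT : forall x, W x.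
    apply: (rho_irr _ _ x00).
    - move=> c _ _ [b ->] [b' ->]; exists (fun a => c * b a + b' a).
      rewrite scaler_sumr -big_split; apply: eq_bigr => a _.
      by rewrite /= scalerA -scalerDl.
    - move=> h _ [b ->].
      have /choice[u uE] : forall a, exists c,
          rho h (rho (sec a) x0) = c *: rho (sec (pr h + a)) x0.
        by move=> a; have [c _ cE] := rho_sec_mul h a x0; exists c.
      exists (fun a => b (a - pr h) * u (a - pr h)).
      rewrite -[RHS](sum_addl _ (pr h)) linear_sum; apply: eq_bigr => a _.
      by rewrite linearZ /= uE scalerA [pr h + a]addrC addrK.
    - have [c c0 cE] := pr_ker (secK 0).
      exists (fun a => (a == 0)%:R * c^-1).
      rewrite (bigD1_seq 0) //= big1_seq ?addr0 => [|a /andP[/negPf-> _]].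
        by rewrite eqxx mul1r cE scalerA mulVf // scale1r.
      by rewrite mul0r scale0r.
  move=> x; have [c ->] := WT x; exists (fun i => c (nth 0 en i)).
  by rewrite (big_nth 0) big_mkord.
case: (ex_minnP span0) => d /asboolP[e espan] dmin.
have [|lam lamP] := minimal_spanning_dual_basis espan.
  by move=> n e' e'P; apply: dmin; apply/asboolP; exists e'.
by exists d, e, lam.
Qed.

Lemma schur d (e : 'I_d -> V) lam (E : V -> V) : dual_basis e lam ->
    linear E -> (forall h x, E (rho h x) = rho h (E x)) ->
  exists t, forall x, E x = t *: x.
Proof.
move=> [lamL lamE lame] EL Ecomm.
have [x0 x00] := V_neq0.
have d0 : (0 < d)%N.
  rewrite lt0n; apply: contraNneq x00 => d0; rewrite (lamE x0).
  by rewrite big1 // => i; have := ltn_ord i; rewrite [X in (_ < X)%N]d0.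
pose M := \matrix_(i, j) lam j (E (e i)).
have [t /eigenvalueP[v vM v0]] := eigenvalue_closed M d0.
exists t; pose x1 := \sum_i v 0 i *: e i.
have E0 : E 0 = 0.
  by have := EL 1 0 0; rewrite scaler0 addr0 scale1r -[LHS]addr0 => /addrI.
have EZ c x : E (c *: x) = c *: E x by have := EL c x 0; rewrite E0 !addr0.
have Esum (c : 'I_d -> C) (y : 'I_d -> V) :
    E (\sum_i c i *: y i) = \sum_i c i *: E (y i).
  rewrite (big_morph E (id1 := 0) (op1 := +%R)) //.
  - by apply: eq_bigr => i _; rewrite EZ.
  - by move=> x y'; have := EL 1 x y'; rewrite !scale1r.
apply: (rho_irr _ _ (x0 := x1)).
- by move=> c x y Wx Wy; rewrite EL Wx Wy scalerDr !scalerA mulrC.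
- by move=> h x Wx; rewrite Ecomm Wx linearZ.
- apply: contraNneq v0 => x10; apply/eqP/rowP => j; rewrite mxE.
  have := scalar_sum (index_enum _) (v 0) e (lamL j); rewrite -/x1 x10.
  under eq_bigr do rewrite lame.
  rewrite (bigD1 j) //= eqxx mulr1 big1 ?addr0 => [<-|i /negPf ij]; last first.
    by rewrite eq_sym ij mulr0.
  by rewrite scalar0.
rewrite Esum; under eq_bigr do rewrite (lamE (E (e _))) scaler_sumr.
rewrite exchange_big scaler_sumr; apply: eq_bigr => j _.
under eq_bigr do rewrite scalerA; rewrite -scaler_suml scalerA; congr (_ *: _).
have /rowP/(_ j) := vM; rewrite !mxE => <-.
by apply: eq_bigr => i _; rewrite mxE.
Qed.

(* In terms of tensors: sum_a (h_a z (x) h_a^-1 y) = c (y (x) z). *)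
Lemma heisenberg_swap d (e : 'I_d -> V) lam : dual_basis e lam ->
  exists2 c, 0 < c & forall (mu : V -> C), scalar mu -> forall z y,
    \sum_(a <- en) mu (rho ((sec a)^-1)%g y) *: rho (sec a) z = (c * mu z) *: y.
Proof.
move=> eP; have [lamL lamE lame] := eP.
have [x0 x00] := V_neq0.
have [j0] : exists j : 'I_d, True.
  case: d e lam eP lamL lamE lame => [|d] e lam _ _ lamE _; last by exists ord0.
  by move: x00; rewrite (lamE x0) big_ord0 eqxx.
pose T mu z y := \sum_(a <- en) mu (rho ((sec a)^-1)%g y) *: rho (sec a) z.
have Tlin mu z : scalar mu -> linear (T mu z).
  move=> muL c x y; rewrite /T scaler_sumr -big_split; apply: eq_bigr => a _.
  by rewrite linearP muL /= scalerA -scalerDl.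
have Tcomm mu z : scalar mu -> forall h x, T mu z (rho h x) = rho h (T mu z x).
  move=> muL h x; rewrite /T linear_sum.
  rewrite -[LHS](sum_class_funMl h (class_fun_tensorV z (rho h x) muL)).
  apply: eq_bigr => a _; by rewrite linearZ /= invgM !rhoM rhoK.
have /choice[g gE] : forall p : {mu : V -> C | scalar mu} * V,
    exists t, forall y, T (sval p.1) p.2 y = t *: y.
  by move=> [[mu muL] z]; apply: (schur eP); [apply: Tlin | apply: Tcomm].
(* Schur's lemma gives only a scalar g(mu, z) for each pair. Replacing h_a by its inverse yields
   g(mu, z) nu(y) = g(nu, y) mu(z), so g(mu, z) is a constant times mu(z). *)
have gsym (p q : {mu : V -> C | scalar mu} * V) :
    g p * sval q.1 q.2 = g q * sval p.1 p.2.
  case: p q => [[mu muL] z] [[nu nuL] y] /=.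
  rewrite -!scalarZ // -!gE /T /= !scalar_sum //.
  have := sum_class_funV (class_fun_tensor y z muL nuL).
  under eq_bigr do rewrite invgK; move=> ->.
  by apply: eq_bigr => a _; rewrite mulrC.
pose q0 : {mu : V -> C | scalar mu} * V := (exist _ (lam j0) (lamL j0), e j0).
have TE mu (muL : scalar mu) z y : T mu z y = (g q0 * mu z) *: y.
  have := gsym (exist _ mu muL, z) q0; rewrite /= lame eqxx mulr1 => <-.
  exact: (gE (exist _ mu muL, z)).
exists (g q0) => //.
have d0 : (0 < d)%N by apply: leq_ltn_trans (ltn_ord j0).
suff -> : g q0 = (size en)%:R / d%:R.
  rewrite divr_gt0 ?ltr0n //.
  by rewrite lt0n size_eq0; apply: contraTneq (en_all 0) => ->.
(* Contracting with the dual basis turns each summand into h_a h_a^-1 = 1, so c d = |A|. *)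
have : \sum_i T (lam i) (e i) (e j0) = (size en)%:R *: e j0.
  rewrite exchange_big /=.
  rewrite (eq_bigr (fun=> e j0)) => [|a _].
    by rewrite big_const_seq iter_addr_0 count_predT scaler_nat.
  rewrite -[RHS](rhoVK (sec a)) [in RHS](lamE (rho _ (e j0))) linear_sum.
  by apply: eq_bigr => i _; rewrite linearZ.
under eq_bigr do rewrite TE // lame eqxx mulr1.
rewrite sumr_const card_ord -scaler_nat => /(congr1 (lam j0)).
rewrite !scalarZ // lame eqxx !mulr1 => <-.
by rewrite mulrAC mulfV ?mul1r // pnatr_eq0 -lt0n.
Qed.

Definition abs_invariant (f : V -> V -> C) :=
  forall h x y, f (rho h x) y = eps (pr h) * f x (rho h y).

Definition abs_nondegenerate (f : V -> V -> C) :=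
  (forall x, (forall y, f x y = 0) -> x = 0) /\
  (forall y, (forall x, f x y = 0) -> y = 0).

Lemma biscalarl (f : {biscalar V}) y : scalar (f ^~ y).
Proof. by move=> c u v; rewrite linearPl. Qed.

Lemma biscalarr (f : {biscalar V}) x : scalar (f x).
Proof. by move=> c u v; rewrite linearPr. Qed.

Lemma invariantV (f : {biscalar V}) h x y : abs_invariant f ->
  f x (rho h y) = eps (pr h) * f (rho h x) y.
Proof. by move=> ->; rewrite mulrA eps_sqr mul1r. Qed.

(** Both radicals of an invariant form are submodules, so irreducibility applies. *)
Lemma invariant_nondegenerate (f : {biscalar V}) x1 y1 :
  abs_invariant f -> f x1 y1 != 0 -> abs_nondegenerate f.
Proof.
move=> finv f1; split=> x fx; apply/eqP/contraT => x0.
  suff E u : forall v, f u v = 0 by rewrite E eqxx in f1.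
  apply: (rho_irr (W := fun u => forall v, f u v = 0) _ _ x0 fx).
    by move=> c a b fa fb v; rewrite linearPl fa fb mulr0 addr0.
  by move=> h a fa v; rewrite finv fa mulr0.
suff E v : forall u, f u v = 0 by rewrite E eqxx in f1.
apply: (rho_irr (W := fun v => forall u, f u v = 0) _ _ x0 fx).
  by move=> c a b fa fb u; rewrite linearPr fa fb mulr0 addr0.
by move=> h a fa u; rewrite invariantV // fa mulr0.
Qed.

Section Average.
Variables lam mu : V -> C.
Hypotheses (lamL : scalar lam) (muL : scalar mu).

Definition average (x y : V) : C :=
  \sum_(a <- en) eps a * (lam (rho (sec a) x) * mu (rho ((sec a)^-1)%g y)).

Lemma average_bilinear : bilinear_for *%R *%R average.
Proof.
split=> [y|x] c u v; rewrite /= /average mulr_sumr -big_split /=;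
  by apply: eq_bigr => a _; rewrite linearP ?lamL ?muL; ring.
Qed.

HB.instance Definition _ :=
  bilinear_isBilinear.Build C V V C *%R *%R average average_bilinear.

Lemma average_invariant : abs_invariant average.
Proof.
move=> k x y.
(* The summand at h k^-1, after k has been moved past h^-1; the last bracket is the resulting
   commutator. The signs multiply to eps(h) eps(k). *)
pose F h := eps (pr h - pr k) *
  (lam (rho h x) * mu (rho ((h^-1)%g) (rho k y)) *
   (eps (pr k - pr h) * eps (pr h) * eps (pr k))).
have Fc : class_fun F.
  move=> h h' hh; rewrite /F hh.
  by rewrite (class_fun_tensor x (rho k y) lamL muL hh).
transitivity (\sum_(a <- en) F (sec a * k)%g).
  apply: eq_bigr => a _; rewrite /F prM secK addrK -!rhoM.
  have -> : (sec a)^-1%g = (k * (sec a * k)^-1)%g.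
    by rewrite invgM mulgA mulgV mul1g.
  rewrite [rho (k * _)%g _]rho_comm scalarZ // prV prM secK epsN.
  by rewrite mulrCA !mulrA; ring.
rewrite (sum_class_funMr k Fc) mulr_sumr; apply: eq_bigr => a _.
rewrite /F secK; have -> : eps (pr k - a) = eps (a - pr k).
  by rewrite -opprB epsN.
set l := lam _; set m := mu _; set p := eps (pr k); set q := eps a.
transitivity (p * (q * (l * m)) * (eps (a - pr k) * eps (a - pr k))).
  by ring.
by rewrite eps_sqr mulr1.
Qed.

Definition average_form : {biscalar V} := average.

End Average.

(** Contracting the averages of lam_i (x) lam_j over j at (e_j, x0) gives S lam_i(x0). As S is
    nonzero, they cannot all vanish. *)
Lemma exists_invariant_form :
  exists f : {biscalar V}, abs_nondegenerate f /\ abs_invariant f.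
Proof.
have [d [e [lam [lamL lamE lame]]]] := exists_dual_basis.
have [x0 x00] := V_neq0.
suff [i [j [x [y fxy]]]] :
    exists i j x y, average_form (lamL i) (lamL j) x y != 0.
  exists (average_form (lamL i) (lamL j)).
  by split; [apply: invariant_nondegenerate fxy|]; apply: average_invariant.
apply: contra_notP (elimN eqP x00) => /forallNP f0.
rewrite (lamE x0) big1 // => i _.
suff -> : lam i x0 = 0 by rewrite scale0r.
apply: (mulfI (lt0r_neq0 eps_sum_gt0)); rewrite mulr0 mulr_suml.
transitivity (\sum_j average (lam i) (lam j) (e j) x0); last first.
  apply: big1 => j _; apply/eqP/contraT => fij.
  by case: (f0 i); exists j, (e j), x0.
rewrite exchange_big; apply: eq_bigr => a _; rewrite -mulr_sumr; congr (_ * _).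
rewrite -[in LHS](rhoVK (sec a) x0) [in LHS](lamE (rho _ x0)) linear_sum.
under eq_bigr do rewrite linearZ /=.
by rewrite scalar_sum //; apply: eq_bigr => j _; rewrite mulrC.
Qed.

Lemma exists_nonzero (f : {biscalar V}) :
  abs_nondegenerate f -> exists x y, f x y != 0.
Proof.
move=> [fl _]; have [x0 x00] := V_neq0.
apply: contra_notP (elimN eqP x00) => /forallNP f0; apply: fl => y.
by apply/eqP/contraT => fxy; case: (f0 x0); exists y.
Qed.

(** By the swap identity, c f(x, z) g(w, y) and c f(w, y) g(x, z) expand into the same sum over A,
    the signs from f and g cancelling. *)
Lemma invariant_form_unique (f g : {biscalar V}) :
  abs_nondegenerate f -> abs_invariant f ->
  abs_nondegenerate g -> abs_invariant g ->
  exists c, c != 0 /\ forall x y, g x y = c * f x y.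
Proof.
move=> fnd finv gnd ginv.
have [d [e [lam eP]]] := exists_dual_basis.
have [c c0 swap] := heisenberg_swap eP.
have E x z w y : f x z * g w y = f w y * g x z.
  apply: (mulfI (lt0r_neq0 c0)); rewrite !mulrA.
  transitivity (g w ((c * f x z) *: y)); first by rewrite linearZr_LR.
  transitivity (g ((c * f w y) *: x) z); last by rewrite linearZl_LR.
  rewrite -(swap _ (biscalarr f x) z y) -(swap _ (biscalarl f y) w x).
  rewrite linear_sumr linear_sumlz; apply: eq_bigr => a _.
  rewrite linearZr_LR linearZl_LR /= invariantV // invariantV //.
  by rewrite prV secK epsN mulrACA eps_sqr mul1r.
have [w [y fwy]] := exists_nonzero fnd.
have [x1 [y1 gxy]] := exists_nonzero gnd.
have gE x z : g x z = (g w y / f w y) * f x z.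
  by rewrite mulrAC [g w y * _]mulrC E mulrAC mulfV // mul1r.
exists (g w y / f w y); split=> //.
by apply: contraNneq gxy => E0; rewrite gE E0 mul0r.
Qed.

Lemma invariant_form_symmetric (f : {biscalar V}) :
  abs_nondegenerate f -> abs_invariant f -> forall x y, f x y = f y x.
Proof.
move=> fnd finv; have [d [e [lam eP]]] := exists_dual_basis.
have [lamL lamE _] := eP.
have [c c0 swap] := heisenberg_swap eP.
set S := \sum_(a <- en) eps a; have S0 : 0 < S by [].
have E x y : S * f x y = c * f y x.
  rewrite {2}(lamE x) linear_sumr mulr_sumr.
  transitivity (\sum_(a <- en) f (rho (sec a) x) (rho ((sec a)^-1)%g y)).
    rewrite mulr_suml; apply: eq_bigr => a _.
    by rewrite finv rhoVK secK.
  transitivity (\sum_(a <- en) \sum_i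
      lam i (rho ((sec a)^-1)%g y) * f (rho (sec a) x) (e i)).
    apply: eq_bigr => a _; rewrite {1}(lamE (rho _ y)) linear_sumr.
    by apply: eq_bigr => i _; rewrite linearZr_LR.
  rewrite exchange_big; apply: eq_bigr => i _.
  rewrite linearZr_LR mulrA -linearZl_LR -swap // linear_sumlz.
  by apply: eq_bigr => a _; rewrite linearZl_LR.
have [x1 [y1 f1]] := exists_nonzero fnd.
(* Applying [E] twice gives S^2 = c^2, and both are positive. *)
have Sc : S = c.
  apply/eqP; rewrite -(eqrXn2 (n := 2)) ?ltW //; apply/eqP/(mulIf f1).
  by rewrite !expr2 -!mulrA E mulrCA E.
by move=> x y; apply: (mulfI (lt0r_neq0 c0)); rewrite -E Sc.
Qed.

End AbstractHeisenberg.

(** * The sign function on N/M and the conclusion *)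

Section DiscriminantForm.
Variables (R : realType) (L : integral_lattice) (s : {additive L -> L}).
Hypotheses (Leven : is_even L) (s_aut : is_automorphism s).
Hypotheses (s_inv : forall x, s (s x) = x).
Hypothesis s_even : forall a : L, (2 %| lat_form a (s a))%Z.

Definition lat_sign (x : L) : R[i] := (-1) ^ (lat_form x x %/ 2)%Z.

Lemma sign_sqr (z : int) : (-1) ^ z * (-1) ^ z = 1 :> R[i].
Proof. by rewrite -expfzMl mulrNN mulr1 exp1rz. Qed.

Lemma sign_even (z : int) : (2 %| z)%Z -> (-1) ^ z = 1 :> R[i].
Proof.
by case/dvdzP=> c ->; rewrite mulrC -exprz_exp -exprnP sqrrN expr1n exp1rz.
Qed.

Lemma lat_signD x y :
  lat_sign (x + y) = lat_sign x * lat_sign y * (-1) ^ lat_form x y.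
Proof.
rewrite /lat_sign -!expfzDr ?oppr_eq0 ?oner_eq0 //; congr (_ ^ _).
have /dvdzP[a aE] := Leven x; have /dvdzP[b bE] := Leven y.
rewrite lat_formDl !raddfD /= (lat_formC y x) aE bE !mulzK //.
by rewrite (_ : _ + _ = (a + b + lat_form x y) * 2) ?mulzK //; ring.
Qed.

Lemma lat_signN x : lat_sign (- x) = lat_sign x.
Proof.
rewrite /lat_sign -[- x]sub0r lat_formBl !raddfB raddf0 /= !(lat_formC 0).
by rewrite raddf0 !sub0r opprK.
Qed.

(** N pairs evenly with M, and (y, y) / 2 is even on M; hence the sign descends to A. *)
Lemma lat_sign_latM x y : x \in latN s -> y \in latM s ->
  lat_sign (x + y) = lat_sign x.
Proof.
rewrite latNP // => /eqP sx yM; rewrite lat_signD [lat_sign y]sign_even.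
  case/asboolP: yM => z ->; rewrite lat_form_sub_invol // sign_even ?mulr1 //.
  by rewrite dvdz_mulr.
have /dvdzP[a ->] := lat_form_latM Leven s_aut s_inv s_even yM.
by rewrite (_ : a * 4 = a * 2 * 2) ?mulzK ?dvdz_mull //; ring.
Qed.

Definition discr_sign (a : latA s) : R[i] :=
  lat_sign (val (repr a : latN_type s)).

Lemma classA_surj (a : latA s) : exists x : latN_type s, classA x = a.
Proof. by exists (repr a); apply: reprK. Qed.

Lemma discr_signE (x : latN_type s) : discr_sign (classA x) = lat_sign (val x).
Proof.
have /classA_eq : classA (repr (classA x) : latN_type s) = classA x.
  by apply: reprK.
move=> xM; rewrite /discr_sign -[in LHS](subrK (val x) (val _)) addrC.
by rewrite lat_sign_latM // (valP x).
Qed.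

Lemma classAD (x y : latN_type s) : classA (x + y) = classA x + classA y.
Proof. exact: raddfD. Qed.

Lemma classAN (x : latN_type s) : classA (- x) = - classA x.
Proof. exact: raddfN. Qed.

Lemma discr_sign_sqr a : discr_sign a * discr_sign a = 1.
Proof. exact: sign_sqr. Qed.

Lemma discr_signN a : discr_sign (- a) = discr_sign a.
Proof.
have [x <-] := classA_surj a.
by rewrite -classAN !discr_signE raddfN lat_signN.
Qed.

Lemma discr_signD (x y : latN_type s) :
  discr_sign (classA x + classA y) * discr_sign (classA x) *
    discr_sign (classA y) =
  (-1) ^ lat_form (val x) (val y).
Proof.
rewrite -classAD !discr_signE raddfD lat_signD.
set p := lat_sign _; set q := lat_sign _; set c := _ ^ _.
transitivity (p * p * (q * q) * c); first by ring.
by rewrite !sign_sqr !mul1r.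
Qed.

End DiscriminantForm.

(** Removing duplicates from the list of classes enumerates A, which is thereby finite, and divides
    the sum by n > 0. *)
Lemma discriminant_sum_gt0 (R : realType) (L : integral_lattice)
    (s : {additive L -> L}) (r : nat)
    (Lpos : is_positive_definite L) (Leven : is_even L)
    (Ldual : is_self_dual L)
    (s_aut : is_automorphism s) (s_inv : forall x, s (s x) = x)
    (rank_fix : has_rank (fixed_sublattice s) r) (r8 : (8 %| r)%N)
    (s_even : forall a : L, (2 %| lat_form a (s a))%Z) :
  exists en : seq (latA s), [/\ uniq en, forall a, a \in en
    & 0 < \sum_(a <- en) discr_sign R a].
Proof.
have [us [usN [n n0 nE] us0]] :=
  latA_gauss_sum_gt0 R Lpos Leven Ldual s_aut s_inv s_even rank_fix r8.
pose cl (u : L) : latA s := classA (insubd (0 : latN_type s) u).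
have clE u (uN : u \in latN s) : val (insubd (0 : latN_type s) u) = u.
  by rewrite insubdK.
pose cs := [seq cl u | u <- us].
have count_cs a : count_mem a cs = n.
  have [x <-] := classA_surj a.
  rewrite -(nE (val x) (valP x)) count_map; apply: eq_in_count => u /usN uN /=.
  apply/eqP/idP => [/classA_eq|uM]; first by rewrite clE.
  by apply/classA_eq; rewrite clE.
exists (undup cs); split; first exact: undup_uniq.
  by move=> a; rewrite mem_undup -has_pred1 has_count count_cs.
rewrite -(pmulr_rgt0 _ (_ : 0 < n%:R)) ?ltr0n //.
suff -> : n%:R * \sum_(a <- undup cs) discr_sign R a =
  \sum_(u <- us) (-1) ^ (lat_form u u %/ 2)%Z by [].
transitivity (\sum_(a <- cs) discr_sign R a).
  rewrite -[RHS]big_undup_iterop_count mulr_sumr; apply: eq_bigr => a _.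
  by rewrite count_cs -[iterop _ _ _ _]/(_ *+ n) mulr_natl.
rewrite big_map; apply: eq_big_seq => u /usN uN.
by rewrite discr_signE // clE.
Qed.

Theorem theorem15p7 (R : realType) (L : integral_lattice)
    (s : {additive L -> L}) (r : nat)
    (Lpos : is_positive_definite L) (Leven : is_even L)
    (Ldual : is_self_dual L)
    (s_aut : is_automorphism s) (s_two : has_order_two s)
    (rank_fix : has_rank (fixed_sublattice s) r) (r8 : (8 %| r)%N)
    (s_even : forall a : L, (2 %| lat_form a (s a))%Z)
    (H : heisenberg_group R s) (X : lmodType R[i])
    (rho : H -> {linear X -> X})
    (rho_act : is_action rho) (rho_scal : scalars_act_by_scaling rho)
    (rho_irr : is_irreducible rho) :
  [/\ exists f : {biscalar X}, is_nondegenerate f /\ is_invariant rho f,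
      forall f g : {biscalar X},
        is_nondegenerate f -> is_invariant rho f ->
        is_nondegenerate g -> is_invariant rho g ->
        exists c : R[i], c != 0 /\ forall x y : X, g x y = c * f x y
    & forall f : {biscalar X},
        is_nondegenerate f -> is_invariant rho f -> is_symmetric f].
Proof.
have [s_inv _] := s_two.
have [en [en_uniq en_all en_gt0]] :=
  discriminant_sum_gt0 R Lpos Leven Ldual s_aut s_inv rank_fix r8 s_even.
have [rho1 rhoM] := rho_act; have [X0 irr] := rho_irr.
have signE := discr_signE R Leven s_aut s_inv s_even.
have surj := classA_surj (s := s).
have sqr := @discr_sign_sqr R L s.
have signN := discr_signN R Leven s_aut s_inv s_even.
have ker (h : H) : heis_proj h = 0 ->
    exists2 c, c != 0 & forall x, rho h x = c *: x.
  by case/heis_exact=> c [c0 ->]; exists c => // x; apply: rho_scal.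
have comm (h k : H) x : rho (h * k)%g x =
    (discr_sign R (heis_proj h + heis_proj k) * discr_sign R (heis_proj h) *
     discr_sign R (heis_proj k)) *: rho (k * h)%g x.
  have [a aE] := surj (heis_proj h); have [b bE] := surj (heis_proj k).
  rewrite -aE -bE discr_signD //.
  have z0 : (-1) ^ lat_form (val a) (val b) != 0 :> R[i].
    by rewrite expfz_neq0 // oppr_eq0 oner_eq0.
  (* The sign is the scalar by which the commutator of h and k acts. *)
  rewrite -(rho_scal _ _ z0) -rhoM -(heis_commutator (esym aE) (esym bE)).
  by rewrite !mulgA !mulgVK.
have irrW (W : X -> Prop) :
    (forall c x y, W x -> W y -> W (c *: x + y)) ->
    (forall h x, W x -> W (rho h x)) ->
    forall x0, x0 != 0 -> W x0 -> forall x, W x.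
  move=> WL Wr x0 x00 Wx0 x.
  have W0 : W 0 by have := WL (-1) _ _ Wx0 Wx0; rewrite scaleN1r addNr.
  case: (irr W) => [//|W1|WT]; last by have : setT x by []; rewrite -WT.
  by move: x00; have : W x0 by []; rewrite W1 => ->; rewrite eqxx.
have invP (f : {biscalar X}) :
    is_invariant rho f <->
    abs_invariant (@heis_proj _ _ _ H) rho (@discr_sign R L s) f.
  split=> finv h x y.
    by have [a aE] := surj (heis_proj h); rewrite -aE signE (finv x y a).
  by move=> h' hE; rewrite finv hE signE.
split.
- have [f [fnd finv]] := exists_invariant_form rho1 rhoM (@heis_projM _ _ _ H)
    (@heis_proj_surj _ _ _ H) ker sqr signN comm X0 irrW en_uniq en_all en_gt0.
  by exists f; split=> //; apply/invP.
- move=> f g fnd /invP finv gnd /invP ginv.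
  exact: (invariant_form_unique rho1 rhoM (@heis_projM _ _ _ H)
    (@heis_proj_surj _ _ _ H) ker sqr signN X0 irrW en_uniq en_all
    fnd finv gnd ginv).
- move=> f fnd /invP finv.
  exact: (invariant_form_symmetric rho1 rhoM (@heis_projM _ _ _ H)
    (@heis_proj_surj _ _ _ H) ker X0 irrW en_uniq en_all en_gt0 fnd finv).
Qed.
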